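(* We have $c_0^\times \leq_B E^C_{\mathrm{Diff}([0,1])}$.
   Context: $\mathcal{H}^+([0,1])$ is the group of increasing homeomorphisms of $[0,1]$ onto itself, with the supremum metric. $\mathrm{Diff}([0,1]) = \{f \in \mathcal{H}^+([0,1]) : f' \in \mathcal{C}([0,1]),\ (f^{-1})' \in \mathcal{C}([0,1])\}$ (one-sided derivatives at the endpoints), with the metric $d_{\mathrm{Diff}}(f,g) = \sup_{t\in[0,1]}|f(t)-g(t)| + \sup_{t\in[0,1]}|f'(t)-g'(t)|$; this makes it a Polish group whose Borel structure coincides with that generated by the supremum metric. $E^C_{\mathrm{Diff}([0,1])}$ is the conjugation equivalence relation on $\mathrm{Diff}([0,1])$: $f_1\, E^C_{\mathrm{Diff}([0,1])}\, f_2$ iff there is $g \in \mathrm{Diff}([0,1])$ with $g\circ f_1 \circ g^{-1} = f_2$. $c_0^\times$ is the equivalence relation on $(0,1)^{\mathbb{N}}$ given by $(x_n)\, c_0^\times\, (y_n)$ iff $\lim_{n\to\infty} x_n/y_n = 1$. For equivalence relations $E, F$ on standard Borel spaces $X, Y$: $E \leq_B F$ means there is a Borel map $f: X \to Y$ with $x E y \iff f(x) F f(y)$ for all $x,y\in X$. *)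

(* Defs.v *)
From HB Require Import structures.
From mathcomp Require Import all_boot all_order all_algebra.
From mathcomp Require Import all_classical all_reals all_analysis.
From mathcomp Require Import lra.

Set Implicit Arguments.
Unset Strict Implicit.
Unset Printing Implicit Defensive.

Import Order.TTheory GRing.Theory Num.Theory.
Import numFieldNormedType.Exports.

Local Open Scope classical_set_scope.
Local Open Scope ring_scope.

(* The intervals [0,1] and (0,1), as sets; used as types they carry the
   subspace topology of the library (subtype_topology). *)
Definition I01 (R : realType) : set R := `[0, 1].
Definition O01 (R : realType) : set R := `]0, 1[.
Arguments I01 R : clear implicits.
Arguments O01 R : clear implicits.

Section unit_interval_calculus.
Context {R : realType}.
Implicit Types h : I01 R -> R.

(* Since x^' is the filter of punctured neighbourhoods of x inside [0,1],
   the limit of the difference quotient along it is the two-sided derivative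
   at interior points and the one-sided derivative at 0 and at 1. *)
Definition diffquot01 h (x y : I01 R) : R := (h y - h x) / (\val y - \val x).
Definition derivable01 h (x : I01 R) : Prop := cvg (diffquot01 h x @ x^').
Definition derive01 h (x : I01 R) : R := lim (diffquot01 h x @ x^').

Definition C1_01 h : Prop :=
  (forall x, derivable01 h x) /\ continuous (derive01 h).

End unit_interval_calculus.

(* The stored inverse is determined by the function: see diff01_eq. *)
Record homeo01 (R : realType) := Homeo01 {
  homeo01_fun :> I01 R -> I01 R ;
  homeo01_inv : I01 R -> I01 R ;
  homeo01_funK : cancel homeo01_fun homeo01_inv ;
  homeo01_invK : cancel homeo01_inv homeo01_fun ;
  homeo01_incr : forall s t : I01 R,
    \val s < \val t -> \val (homeo01_fun s) < \val (homeo01_fun t) ;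
  homeo01_fun_continuous : continuous homeo01_fun ;
  homeo01_inv_continuous : continuous homeo01_inv }.

Record diff01 (R : realType) := Diff01 {
  diff01_homeo :> homeo01 R ;
  diff01_C1 : C1_01 (fun t => \val (diff01_homeo t)) ;
  diff01_inv_C1 : C1_01 (fun t => \val (homeo01_inv diff01_homeo t)) }.

Definition diff01_derive (R : realType) (f : diff01 R) : I01 R -> R :=
  derive01 (fun t => \val (f t)).

Definition supdist01 (R : realType) (u v : I01 R -> R) : R :=
  sup [set `|u t - v t| | t in [set: I01 R]].

Definition dist_diff01 (R : realType) (f g : diff01 R) : R :=
  supdist01 (fun t => \val (f t)) (fun t => \val (g t)) +
  supdist01 (diff01_derive f) (diff01_derive g).

HB.instance Definition _ (R : realType) := gen_eqMixin (diff01 R).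
HB.instance Definition _ (R : realType) := gen_choiceMixin (diff01 R).

Section dist_diff01_metric.
Context {R : realType}.
Implicit Types (f g h : diff01 R) (u v w : I01 R -> R).

Lemma mem0_I01 : (0 : R) \in I01 R.
Proof. by rewrite inE /I01 /= in_itv /= lexx ler01. Qed.

Let zero01 : I01 R := exist _ 0 mem0_I01.

Lemma continuous_I01_bounded u :
  continuous u -> exists M : R, forall t, `|u t| <= M.
Proof.
move=> cu.
pose F (x : R) : R := if insub x is Some t then u t else 0.
have FE : sigL (I01 R) F = u.
  by apply/funext => t; rewrite /sigL /= /F set_valE/= valK.
have cF : {within I01 R, continuous F}.
  by apply/subspace_sigL_continuousP; rewrite FE.
have /compact_bounded : compact (F @` I01 R).
  by apply: continuous_compact => //; exact: segment_compact.
case=> M [_ MP]; exists (M + 1) => t.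
apply: (MP (M + 1)); first by rewrite ltrDl.
by exists (\val t); [exact: set_valP | rewrite /F valK].
Qed.

Let supdist_has_sup u v : (exists M, forall t, `|u t| <= M) ->
  (exists M, forall t, `|v t| <= M) ->
  has_sup [set `|u t - v t| | t in [set: I01 R]].
Proof.
move=> [M uM] [N vN]; split; first by exists (`|u zero01 - v zero01|), zero01.
exists (M + N) => _ [t _ <-].
by rewrite (le_trans (ler_normB _ _))// lerD.
Qed.

Let supdist_ub u v t : (exists M, forall t, `|u t| <= M) ->
  (exists M, forall t, `|v t| <= M) -> `|u t - v t| <= supdist01 u v.
Proof.
by move=> bu bv; apply: (sup_upper_bound (supdist_has_sup bu bv)); exists t.
Qed.

Let supdist_ge0 u v : (exists M, forall t, `|u t| <= M) ->
  (exists M, forall t, `|v t| <= M) -> 0 <= supdist01 u v.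
Proof.
by move=> bu bv; exact: le_trans (normr_ge0 _) (supdist_ub zero01 bu bv).
Qed.

Let supdistxx u : supdist01 u u = 0.
Proof.
rewrite /supdist01 (_ : [set _ | _ in _] = [set 0]) ?sup1//.
apply/seteqP; split=> [_ [t _ <-]|_ ->] /=; first by rewrite subrr normr0.
by exists zero01 => //; rewrite subrr normr0.
Qed.

Let supdistC u v : supdist01 u v = supdist01 v u.
Proof.
by congr sup; apply/seteqP; split=> _ [t _ <-]; exists t => //; rewrite distrC.
Qed.

Let supdist_triangle v u w : (exists M, forall t, `|u t| <= M) ->
  (exists M, forall t, `|v t| <= M) -> (exists M, forall t, `|w t| <= M) ->
  supdist01 u w <= supdist01 u v + supdist01 v w.
Proof.
move=> bu bv bw; apply: ge_sup.
  by exists (`|u zero01 - w zero01|), zero01.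
move=> _ [t _ <-]; rewrite (le_trans (ler_distD (v t) _ _))//.
by rewrite lerD// supdist_ub.
Qed.

Let bounded_fun f : exists M, forall t, `|\val (f t)| <= M.
Proof.
exists 1 => t; have := set_valP (f t); rewrite /I01 /= in_itv/= => /andP[f0 f1].
by rewrite ger0_norm.
Qed.

Let bounded_derive f : exists M, forall t, `|diff01_derive f t| <= M.
Proof. exact/continuous_I01_bounded/(diff01_C1 f).2. Qed.

Lemma diff01_eq f g : (forall t, f t = g t) -> f = g.
Proof.
case: f g => -[f fi fK fiK fm fc fic] fC1 fiC1 [[g gi gK giK gm gc gic]] gC1 giC1.
move=> /= fg.
have {}fg : f = g by apply/funext.
subst g.
have figi : fi = gi by apply/funext => t; rewrite -{1}(giK t) fK.
subst gi.
move: fC1 fiC1 gC1 giC1.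
rewrite (Prop_irrelevance gK fK) (Prop_irrelevance giK fiK).
rewrite (Prop_irrelevance gm fm) (Prop_irrelevance gc fc).
rewrite (Prop_irrelevance gic fic) => *.
by congr Diff01; exact: Prop_irrelevance.
Qed.

Let dist_diff01xx f : dist_diff01 f f = 0.
Proof. by rewrite /dist_diff01 !supdistxx addr0. Qed.

Let dist_diff01_eq0 f g : dist_diff01 f g = 0 -> f = g.
Proof.
move=> /eqP; rewrite paddr_eq0; last 2 first.
- exact: supdist_ge0 (bounded_fun f) (bounded_fun g).
- exact: supdist_ge0 (bounded_derive f) (bounded_derive g).
move=> /andP[/eqP fg0 _]; apply: diff01_eq => t.
have := supdist_ub t (bounded_fun f) (bounded_fun g).
by rewrite fg0 normr_le0 subr_eq0 => /eqP /val_inj.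
Qed.

Let dist_diff01C f g : dist_diff01 f g = dist_diff01 g f.
Proof. by congr (_ + _); exact: supdistC. Qed.

Let dist_diff01_triangle g f h :
  dist_diff01 f h <= dist_diff01 f g + dist_diff01 g h.
Proof.
rewrite /dist_diff01 addrACA lerD//.
- exact: supdist_triangle (bounded_fun f) (bounded_fun g) (bounded_fun h).
- exact: supdist_triangle (bounded_derive f) (bounded_derive g)
    (bounded_derive h).
Qed.

HB.instance Definition _ := isMetric.Build R (diff01 R)
  dist_diff01xx dist_diff01_eq0 dist_diff01C dist_diff01_triangle.

End dist_diff01_metric.

Section points.
Context {R : realType}.

Lemma mem_half_O01 : (2^-1 : R) \in O01 R.
Proof.
by rewrite inE /O01 /= in_itv /= invr_gt0 ltr0n /= invf_lt1 ?ltr0n// ltr1n.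
Qed.

HB.instance Definition _ := isPointed.Build (O01 R)
  (exist (fun x : R => x \in O01 R) _ mem_half_O01).

Lemma I01_step (v d : R) : 0 <= v -> v <= 1 -> 0 < d -> d <= 2^-1 ->
  0 <= (if v <= 2^-1 then v + d else v - d) <= 1.
Proof.
have h : (2^-1 : R) + 2^-1 = 1 by rewrite -div1r -splitr.
move: h; set c := 2^-1 => h v0 v1 d0 d2.
by case: (leP v c) => v2; apply/andP; split; lra.
Qed.

Lemma I01_dnbhs_proper (x : I01 R) : ProperFilter x^'.
Proof.
apply: Build_ProperFilter_ex => P xP.
have /nbhs_ballP[e /= e0 eP] : nbhs x (fun y => y != x -> P y) by [].
pose d : R := Num.min (e / 2) (2^-1).
have d0 : 0 < d by rewrite lt_min divr_gt0//= invr_gt0.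
have de : d < e by rewrite gt_min ltr_pdivrMr// ltr_pMr// ltr1n.
have d2 : d <= 2^-1 by rewrite ge_min lexx orbT.
have [x0 x1] : 0 <= \val x /\ \val x <= 1.
  by apply/andP; have := set_valP x; rewrite /I01 /= in_itv.
pose y := if \val x <= 2^-1 then \val x + d else \val x - d.
have y01 : y \in I01 R.
  by rewrite inE /I01 /= in_itv/=; exact: I01_step.
have [z zy] : exists z : I01 R, \val z = y by exists (exist _ y y01).
have zx : \val z - \val x = d \/ \val z - \val x = - d.
  by rewrite zy /y; case: ifPn => _; [left|right]; rewrite addrAC subrr add0r.
exists z; apply: eP.
  change (`|\val x - \val z| < e); rewrite distrC.
  by case: zx => ->; rewrite ?normrN gtr0_norm.
by rewrite -val_eqE/= -subr_eq0; case: zx => ->; rewrite ?oppr_eq0 gt_eqF.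
Qed.

Lemma diffquot01_id (x : I01 R) :
  diffquot01 (fun t : I01 R => \val t) x @ x^' --> (1 : R).
Proof.
apply: cvg_near_cst; apply: filterS (nbhs_dnbhs_neq x) => y yx.
by rewrite /diffquot01 divff// subr_eq0 val_eqE.
Qed.

Lemma C1_01_id : C1_01 (fun t : I01 R => \val t).
Proof.
have E : derive01 (fun t : I01 R => \val t) = cst 1.
  apply/funext => x; have := I01_dnbhs_proper x => ?.
  by apply: cvg_lim; [exact: Rhausdorff | exact: diffquot01_id].
split=> [x|]; first by apply/cvg_ex; exists 1; exact: diffquot01_id.
by rewrite E; exact: cst_continuous.
Qed.

Definition homeo01_id : homeo01 R :=
  @Homeo01 R id id (fun=> erefl) (fun=> erefl) (fun _ _ => id)
    (fun=> cvg_id) (fun=> cvg_id).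

Definition diff01_id : diff01 R := @Diff01 R homeo01_id C1_01_id C1_01_id.

HB.instance Definition _ := isPointed.Build (diff01 R) diff01_id.

End points.

Definition O01_seq (R : realType) : Type := {ptws nat -> O01 R}.
HB.instance Definition _ (R : realType) :=
  Topological.copy (O01_seq R) {ptws nat -> O01 R}.
HB.instance Definition _ (R : realType) :=
  isPointed.Build (O01_seq R) (fun=> point).

(* Borel maps are the measurable maps between the Borel sigma-algebras. *)
Notation borelType X := (g_sigma_algebraType (@open X)).

Definition borel_reducible (X Y : ptopologicalType)
    (E : X -> X -> Prop) (F : Y -> Y -> Prop) : Prop :=
  exists2 f : X -> Y,
    measurable_fun [set: borelType X] (f : borelType X -> borelType Y) &
    forall x y, E x y <-> F (f x) (f y).
Arguments borel_reducible : clear implicits.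

Definition c0x (R : realType) (x y : O01_seq R) : Prop :=
  (fun n => \val (x n) / \val (y n)) @ \oo --> (1 : R).

Definition conj_diff01 (R : realType) (f1 f2 : diff01 R) : Prop :=
  exists g : diff01 R, g \o f1 \o homeo01_inv g = f2.

(* Main.v *)
Require Import Defs.
From mathcomp Require Import all_boot all_order all_algebra.
From mathcomp Require Import all_classical all_reals all_analysis.
From mathcomp Require Import ring lra.

(* Encode x by numbers z_m in [0,1]: enumerating the pairs (n, k) by m, put
   z_m = min (1, (k+1) x_n).  Since (k+1) x_n is between 1/2 and 1 for a
   suitable k, x_n / y_n tends to 1 iff z_m(x) - z_m(y) tends to 0.
   Let f_x be the identity of [0,1] perturbed, in each dyadic interval
   ]2^-(m+1), 2^-m[, by one small bump whose position is translated
   proportionally to z_m; the bumps are damped by 2^-m, so f_x is C^1 and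
   depends continuously on x.
   If z_m(x) - z_m(y) tends to 0, the map translating each bump of f_x onto the
   corresponding bump of f_y and fixing the dyadic points is C^1, with
   derivative 1 at 0, and conjugates f_x to f_y.
   Conversely, a conjugacy g from f_x to f_y preserves the order of the
   components of the set of moved points, so it sends the left endpoint of the
   m-th bump of f_x to that of f_y; the ratio of these endpoints then tends to
   g'(0).  For fixed n both codes are 1 once k is large, so this ratio is 1
   infinitely often; hence g'(0) = 1 and z_m(x) - z_m(y) tends to 0. *)

Set Implicit Arguments.
Unset Strict Implicit.
Unset Printing Implicit Defensive.

Import Order.TTheory GRing.Theory Num.Theory.
Import numFieldNormedType.Exports.

Local Open Scope classical_set_scope.
Local Open Scope ring_scope.

(** * Bumps and plateaus on the line *)

Section real_calculus.
Context {R : realType}.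
Implicit Types (f h : R -> R) (x y d e : R).

(** The quotient-free form makes sense at [y = x] as well, and error bounds can be fed to it
    directly, which is how differentiability at 0 is proved below. *)
Lemma is_derive1P f x d : is_derive x 1 f d <->
  forall e, 0 < e ->
    \forall y \near x, `|f y - f x - d * (y - x)| <= e * `|y - x|.
Proof.
have quotE (h : R) : `|f (h + x) - f x - d * h| =
    `|h| * `|d - h^-1 *: (f (h + x) - f x)| \/ h = 0.
  have [->|h0] := eqVneq h 0; [by right | left].
  rewrite -normrM -normrN; congr (`|_|); rewrite /GRing.scale /=.
  by field.
split=> [[df limf] e e0|H].
  have /cvgrPdist_le /(_ _ e0) :
    (fun h : R => h^-1 *: ((f \o shift x) (h *: (1 : R)) - f x)) @ 0^' --> d.
    by rewrite -limf; exact: df.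
  rewrite near_withinE => /nbhs_ballP[r /= r0 rP].
  apply/nbhs_ballP; exists r => //= y xy.
  have [->|yx] := eqVneq y x; first by rewrite !subrr mulr0 subr0 normr0 mulr0.
  have yx0 : y - x != 0 by rewrite subr_eq0.
  have := rP (y - x); rewrite /ball /= sub0r opprB => /(_ xy yx0).
  rewrite /GRing.scale /= mulr1.
  case: (quotE (y - x)) => [|/eqP]; last by rewrite (negPf yx0).
  rewrite subrK => -> le; rewrite mulrC ler_wpM2r//.
suff cvf :
  (fun h : R => h^-1 *: ((f \o shift x) (h *: (1 : R)) - f x)) @ 0^' --> d.
  by apply: DeriveDef; [apply/cvg_ex; exists d | exact: cvg_lim].
apply/cvgrPdist_le => e e0; rewrite near_withinE.
have /nbhs_ballP[r /= r0 rP] := H _ e0.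
apply/nbhs_ballP; exists r => //= h hr h0.
have := rP (h + x); rewrite /ball /= opprD addrCA subrr addr0 normrN.
move: hr; rewrite /ball /= sub0r normrN => hr /(_ hr); rewrite addrK.
case: (quotE h) => [->|/eqP]; last by rewrite (negPf h0).
by rewrite /GRing.scale /= mulr1 mulrC ler_pM2r// normr_gt0.
Qed.

Lemma is_derive1_quad f x d (K : R) :
  (forall y, `|f y - f x - d * (y - x)| <= K * (y - x) ^+ 2) ->
  is_derive x 1 f d.
Proof.
move=> H; apply/is_derive1P => e e0; apply/nbhs_ballP.
have K0 : 0 < `|K| + 1 by rewrite ltr_wpDl.
exists (e / (`|K| + 1)) => /=; first exact: divr_gt0.
move=> y; rewrite /ball /= distrC => xy; apply: (le_trans (H y)).
rewrite -[(y - x) ^+ 2]ger0_norm ?sqr_ge0// normrX expr2 mulrA ler_wpM2r//.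
apply: (@le_trans _ _ ((`|K| + 1) * `|y - x|)).
  by rewrite ler_wpM2r// (le_trans (ler_norm K))// lerDl.
by rewrite mulrC -ler_pdivlMr// ltW.
Qed.

(** Squaring the positive part makes it C^1 across 0. All the profiles below are built from it, so
    the piecewise case analysis of derivatives is done only once. *)
Definition sqpos x := Num.max 0 x ^+ 2.

Lemma sqpos_le1 x : x <= 1 -> sqpos x <= 1.
Proof. by move=> x1; rewrite exprn_ile1// ?le_max ?lexx// ge_max ler01. Qed.

Lemma is_derive_sqpos x : is_derive x 1 sqpos (2 * Num.max 0 x).
Proof.
apply: (@is_derive1_quad _ _ _ 1) => y; rewrite /sqpos mul1r ler_norml.
have sq := sqr_ge0 (y - x).
have [x0|x0] := leP 0 x; have [y0|y0] := leP 0 y.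
- by apply/andP; split; nra.
(* In every sign case the remainder lies between 0 and [(y - x) ^+ 2]; for mixed signs this uses
   that the cross term is nonpositive. *)
- have xy : x * y <= 0 by nra.
  by apply/andP; split; nra.
- have xy : x * y <= 0 by nra.
  by apply/andP; split; nra.
- by apply/andP; split; nra.
Qed.

Definition bump x := sqpos (1 - x ^+ 2).
Definition dbump x := - (4 * (x * Num.max 0 (1 - x ^+ 2))).

(** This is the squared distance to [-1, 1]; hence [plateau] is a C^1 cutoff, equal to 1 on [-1, 1]
    and to 0 off ]-2, 2[. *)
Definition ramp x := sqpos (x - 1) + sqpos (- 1 - x).
Definition dramp x := 2 * Num.max 0 (x - 1) - 2 * Num.max 0 (- 1 - x).
Definition plateau x := sqpos (1 - ramp x).
Definition dplateau x := - (2 * Num.max 0 (1 - ramp x) * dramp x).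

Lemma is_derive_bump x : is_derive x 1 bump (dbump x).
Proof.
rewrite (_ : bump = sqpos \o (cst 1 - (@id R) ^+ 2)); last first.
  by apply/funext => t; rewrite /bump /= !fctE.
have ? := is_derive_sqpos ((cst 1 - (@id R) ^+ 2) x).
apply: is_derive_eq; rewrite /dbump /= !fctE /= /GRing.scale /=.
by ring.
Qed.

Lemma is_derive_ramp x : is_derive x 1 ramp (dramp x).
Proof.
rewrite (_ : ramp = (sqpos \o (@id R - cst 1)) +
    (sqpos \o (cst (- 1) - id))); last first.
  by apply/funext => t; rewrite /ramp /= !fctE.
have ? := is_derive_sqpos (((@id R) - cst 1) x).
have ? := is_derive_sqpos ((cst (- 1) - (@id R)) x).
apply: is_derive_eq; rewrite /dramp /= !fctE /=; ring.
Qed.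

Lemma is_derive_plateau x : is_derive x 1 plateau (dplateau x).
Proof.
rewrite (_ : plateau = sqpos \o (cst 1 - ramp)); last first.
  by apply/funext => t; rewrite /plateau /= !fctE.
have ? := is_derive_sqpos ((cst 1 - ramp) x).
have ? := is_derive_ramp x.
apply: is_derive_eq; rewrite /dplateau /= !fctE /=; ring.
Qed.

Lemma is_derive_continuous f (df : R -> R) :
  (forall x, is_derive x 1 f (df x)) -> continuous f.
Proof.
move=> H x; apply/differentiable_continuous/derivable1_diffP.
by case: (H x).
Qed.

Lemma continuous_max0 : continuous (fun x : R => Num.max 0 x).
Proof.
move=> x; have c0 : {for x, continuous (cst 0 : R -> R^o)} by exact: cvg_cst.
exact: (continuous_max c0 (@cvg_id _ _)).
Qed.

Lemma continuous_dbump : continuous dbump.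
Proof.
move=> x; apply: cvgN; apply: cvgM; first exact: cvg_cst.
apply: cvgM => //.
apply: (@continuous_comp _ _ _ (fun x => 1 - x ^+ 2)).
  by apply: cvgB; [exact: cvg_cst | exact: exprn_continuous].
exact: continuous_max0.
Qed.

Lemma bump_ge0 x : 0 <= bump x.
Proof. by rewrite sqr_ge0. Qed.

Lemma bump_le1 x : bump x <= 1.
Proof. by rewrite sqpos_le1// lerBlDl lerDr sqr_ge0. Qed.

Lemma sqr_ge1 x : 1 <= `|x| -> 1 - x ^+ 2 <= 0.
Proof.
by move=> x1; rewrite subr_le0 -[x ^+ 2]ger0_norm ?sqr_ge0// normrX exprn_ege1.
Qed.

Lemma bump_out x : 1 <= `|x| -> bump x = 0.
Proof. by move=> /sqr_ge1 x1; rewrite /bump /sqpos max_l// expr0n. Qed.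

Lemma bump_gt0 x : `|x| < 1 -> 0 < bump x.
Proof.
move=> x1; have x2 : 0 < 1 - x ^+ 2.
  by rewrite subr_gt0 -[x ^+ 2]ger0_norm ?sqr_ge0// normrX exprn_ilt1.
by rewrite /bump /sqpos max_r ?exprn_gt0// ltW.
Qed.

Lemma dbump_out x : 1 <= `|x| -> dbump x = 0.
Proof. by move=> /sqr_ge1 x1; rewrite /dbump max_l// !mulr0 oppr0. Qed.

Lemma dbump_le x : `|dbump x| <= 4.
Proof.
have [/dbump_out ->|x1] := leP 1 `|x|; first by rewrite normr0.
rewrite /dbump normrN !normrM ger0_norm// ler_piMr//.
apply: mulr_ile1 => //; first exact: ltW.
by rewrite ger0_norm ?le_max ?lexx// ge_max ler01 lerBlDl lerDr sqr_ge0.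
Qed.

Lemma lipschitz_deriv f df (K : R) : (forall x, is_derive x 1 f (df x)) ->
  (forall x, `|df x| <= K) -> forall x y, `|f x - f y| <= K * `|x - y|.
Proof.
move=> fd dK; suff H x y : x < y -> `|f y - f x| <= K * `|y - x|.
  move=> x y; have [/H|/H|->] := ltgtP x y; last by rewrite !subrr normr0 mulr0.
    by rewrite distrC [`|y - x|]distrC.
  by [].
move=> xy; have [|c _ ->] := MVT xy (fun z _ => fd z).
  exact/continuous_subspaceT/(is_derive_continuous fd).
by rewrite normrM ler_wpM2r.
Qed.

Lemma bump_lip x y : `|bump x - bump y| <= 4 * `|x - y|.
Proof. exact: lipschitz_deriv is_derive_bump dbump_le x y. Qed.

(** The function [dbump] is the cubic 4(s^3 - s) evaluated at the clamp [c] of its argument to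
    [-1, 1]. The clamp is 1-Lipschitz, and the cubic is 8-Lipschitz on [-1, 1]. *)
Lemma dbump_lip x y : `|dbump x - dbump y| <= 8 * `|x - y|.
Proof.
pose c t : R := if 1 <= t then 1 else if t <= - 1 then - 1 else t.
have cE t : dbump t = 4 * (c t ^+ 3 - c t).
  rewrite /c; case: (leP 1 t) => t1.
    by rewrite dbump_out ?ler_normr ?t1//; ring.
  case: (leP t (- 1)) => t2.
    have t1' : 1 <= `|t| by rewrite ler_normr; apply/orP; right; lra.
    by rewrite dbump_out//; ring.
  rewrite /dbump max_r; first by ring.
  by nra.
have c1 t : -1 <= c t <= 1.
  rewrite /c; case: (leP 1 t) => t1; first by apply/andP; split; lra.
  by case: (leP t (- 1)) => t2; apply/andP; split; lra.
have cl : `|c x - c y| <= `|x - y|.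
  wlog xy : x y / x <= y.
    by move=> H; have [/H//|/ltW/H] := leP x y; rewrite distrC [`|y - x|]distrC.
  rewrite ler0_norm ?[`|x - y|]ler0_norm ?subr_le0// /c;
    case: (leP 1 x) => ?; case: (leP x (- 1)) => ?;
    case: (leP 1 y) => ?; case: (leP y (- 1)) => ?; lra.
rewrite !cE (_ : _ - _ = 4 * ((c x - c y) *
    (c x ^+ 2 + c x * c y + c y ^+ 2 - 1))); last by ring.
rewrite normrM [`|4|]ger0_norm// (_ : 8 * _ = 4 * (`|x - y| * 2)); last by ring.
rewrite ler_pM2l// normrM ler_pM//.
have /andP[? ?] := c1 x; have /andP[? ?] := c1 y.
by rewrite ler_norml; apply/andP; split; nra.
Qed.

Lemma plateau_in x : `|x| <= 1 -> plateau x = 1.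
Proof.
rewrite ler_norml /plateau /ramp /sqpos => /andP[x1 x2].
have h1 : x - 1 <= 0 by lra.
have h2 : - 1 - x <= 0 by lra.
by rewrite (max_l h1) (max_l h2) expr0n addr0 subr0 max_r ?expr1n.
Qed.

Lemma ramp_ge1 x : 2 <= `|x| -> 1 <= ramp x.
Proof.
rewrite ler_normr /ramp /sqpos => /orP[] x2.
  have h1 : 0 <= x - 1 by lra.
  by rewrite (max_r h1) ler_wpDr ?sqr_ge0// exprn_ege1//; lra.
have h1 : 0 <= - 1 - x by lra.
by rewrite (max_r h1) ler_wpDl ?sqr_ge0// exprn_ege1//; lra.
Qed.

Lemma plateau_out x : 2 <= `|x| -> plateau x = 0.
Proof.
by move=> /ramp_ge1 x2; rewrite /plateau /sqpos max_l ?expr0n// subr_le0.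
Qed.

Lemma dplateau_out x : 2 <= `|x| -> dplateau x = 0.
Proof.
move=> /ramp_ge1 x2; rewrite /dplateau max_l ?subr_le0//.
by rewrite mulr0 mul0r oppr0.
Qed.

Lemma ramp_ge0 x : 0 <= ramp x.
Proof. by rewrite addr_ge0 ?sqr_ge0. Qed.

Lemma plateau_ge0 x : 0 <= plateau x.
Proof. by rewrite sqr_ge0. Qed.

Lemma plateau_le1 x : plateau x <= 1.
Proof.
by rewrite sqpos_le1// lerBlDl lerDr ramp_ge0.
Qed.

(** With a = |x|, the base of the square is 1 - (a - 1)^2 = a(2 - a), which lies in [0, 1] and so
    dominates its square. The linear decay keeps shifted points inside their slot. *)
Lemma plateau_le x : 1 <= `|x| -> `|x| <= 2 -> plateau x <= 2 * (2 - `|x|).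
Proof.
move=> x1 x2.
have rE : ramp x = (`|x| - 1) ^+ 2.
  rewrite /ramp /sqpos; have [x0|x0] := leP 0 x.
    rewrite ger0_norm// in x1 *; have h1 : 0 <= x - 1 by lra.
    have h2 : - 1 - x <= 0 by lra.
    by rewrite (max_r h1) (max_l h2) expr0n addr0.
  rewrite ltr0_norm// in x1 *; have h1 : x - 1 <= 0 by lra.
  have h2 : 0 <= - 1 - x by lra.
  by rewrite (max_l h1) (max_r h2) expr0n add0r; ring.
rewrite /plateau rE /sqpos; set a := `|x|.
have r0 : 0 <= 1 - (a - 1) ^+ 2 by rewrite /a; nra.
rewrite max_r// (@le_trans _ _ (1 - (a - 1) ^+ 2))//.
  by rewrite expr2 ler_piMr// lerBlDl lerDr sqr_ge0.
by rewrite /a; nra.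
Qed.

Lemma dplateau_le x : `|dplateau x| <= 4.
Proof.
rewrite /dplateau normrN; have := ramp_ge0 x.
case: (leP 0 (1 - ramp x)) => H r0; last by rewrite mulr0 mul0r normr0.
have : ramp x <= 1 by lra.
rewrite normrM (_ : 4 = 2 * 2) ?ler_pM//; last by ring.
  by rewrite ger0_norm; lra.
rewrite ler_norml /ramp /dramp /sqpos in H r0 *.
case: (leP 0 (x - 1)) H r0; case: (leP 0 (-1 - x)) => *; apply/andP; split; nra.
Qed.

Lemma continuous_dplateau : continuous dplateau.
Proof.
have c0 (u : R -> R) : continuous u ->
    continuous (fun x => 2 * Num.max 0 (u x)).
  move=> cu x; apply: cvgM; first exact: cvg_cst.
  by apply: (@continuous_comp _ _ _ u) (cu x) _; exact: continuous_max0.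
move=> x; apply: cvgN; apply: cvgM.
  apply: (c0 (fun x => 1 - ramp x)) => y; apply: cvgB; first exact: cvg_cst.
  exact: (is_derive_continuous is_derive_ramp).
apply: cvgB.
  by apply: (c0 (fun x => x - 1)) => y; apply: cvgB => //; exact: cvg_cst.
by apply: (c0 (fun x => - 1 - x)) => y; apply: cvgB => //; exact: cvg_cst.
Qed.

End real_calculus.

(** * Glueing functions supported in dyadic slots *)

Section glueing.
Context {R : realType}.
Implicit Types (t s e : R) (m n M : nat).
Implicit Types (B D k : nat -> R -> R) (eps : nat -> R).

(* Maps the slot ]2^-(m+1), 2^-m[ affinely onto ]-2, 2[. *)
Definition coord m t := 8 * (2 ^+ m * t) - 6.
Definition uncoord m s := (s + 6) / (8 * 2 ^+ m).
Definition slot m t := `|coord m t| < 2.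

Lemma pow2_gt0 m : 0 < 2 ^+ m :> R.
Proof. exact: exprn_gt0. Qed.

Lemma coordK m : cancel (coord m) (uncoord m).
Proof.
by move=> t; rewrite /coord /uncoord subrK; field; rewrite gt_eqF ?pow2_gt0.
Qed.

Lemma uncoordK m : cancel (uncoord m) (coord m).
Proof.
by move=> t; rewrite /coord /uncoord; field; rewrite gt_eqF ?pow2_gt0.
Qed.

Lemma slotP m t : slot m t <-> 1 < 2 ^+ m.+1 * t /\ 2 ^+ m * t < 1.
Proof.
rewrite /slot /coord ltr_norml exprS -mulrA; split=> [/andP[]|[]]; first by lra.
by move=> *; apply/andP; split; lra.
Qed.

Lemma slot_gt0 m t : slot m t -> 0 < t.
Proof.
by move=> /slotP[h _]; rewrite -(pmulr_rgt0 t (pow2_gt0 m.+1)) (lt_trans _ h).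
Qed.

Lemma slot_lt1 m t : slot m t -> t < 1.
Proof.
move=> mt; have /slotP[_] := mt; apply: le_lt_trans.
by rewrite ler_peMl ?exprn_ege1 ?ler1n// ltW// (slot_gt0 mt).
Qed.

Lemma slot_lt m n t : slot m t -> 1 <= 2 ^+ n * t -> (m < n)%N.
Proof.
move=> mt nt; rewrite ltnNge; apply/negP => nm.
have /slotP[_] := mt; rewrite ltNge (le_trans nt)//.
by rewrite ler_pM2r ?(slot_gt0 mt)// ler_eXn2l// ltr1n.
Qed.

Lemma slot_inj m n t : slot m t -> slot n t -> m = n.
Proof.
move=> mt nt; apply/eqP; rewrite eqn_leq.
have /slotP[/ltW m1 _] := mt; have /slotP[/ltW n1 _] := nt.
apply/andP; split; rewrite -ltnS; [exact: slot_lt mt n1|exact: slot_lt nt m1].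
Qed.

Lemma pow2_large t : 0 < t -> exists M, 1 < 2 ^+ M * t.
Proof.
move=> t0; exists (Num.truncn t^-1).+1; rewrite -ltr_pdivrMr// div1r.
apply: (lt_trans (truncnS_gt _)).
by rewrite -natrX ltr_nat ltn_expl.
Qed.

Definition slotted B := forall m t, ~~ slot m t -> B m t = 0.

(* The slots are disjoint, so at most one term is nonzero; a slot [m]
   containing [t] has [m < 2 ^ m < t^-1]. *)
Definition glue B t := \sum_(m < Num.truncn t^-1) B m t.

Lemma glue_out B t : slotted B -> (forall m, ~~ slot m t) -> glue B t = 0.
Proof. by move=> sB H; rewrite /glue big1// => i _; exact: sB. Qed.

Lemma sum_slot B M m t : slotted B -> slot m t -> (m < M)%N ->
  \sum_(i < M) B i t = B m t.
Proof.
move=> sB mt mM; rewrite (bigD1 (Ordinal mM))//= big1 ?addr0// => i im.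
apply: sB; apply/negP => it; move/negP: im; apply.
by apply/eqP/val_inj; exact: slot_inj it mt.
Qed.

Lemma glue_in B m t : slotted B -> slot m t -> glue B t = B m t.
Proof.
move=> sB mt; apply: sum_slot => //; rewrite truncn_gt_nat.
have t0 := slot_gt0 mt; have /slotP[_] := mt.
rewrite -ltr_pdivlMr// mul1r => /ltW; apply: le_trans.
by rewrite -natrX ler_nat ltn_expl.
Qed.

Lemma slot_dec t : (exists m, slot m t) \/ (forall m, ~~ slot m t).
Proof.
have [|H] := pselect (exists m, slot m t); [by left | right => m].
by apply/negP => mt; apply: H; exists m.
Qed.

Lemma glue_fin B M t : slotted B -> 1 <= 2 ^+ M * t ->
  glue B t = \sum_(m < M) B m t.
Proof.
move=> sB Mt; have [[m mt]|H] := slot_dec t; last first.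
  by rewrite glue_out// big1// => i _; exact: sB.
by rewrite (glue_in sB mt) (@sum_slot _ _ m)// (slot_lt mt).
Qed.

(** The slots accumulate only at 0, so near a positive point the glued function is a fixed finite
    sum and inherits its regularity. *)
Lemma glue_near_pos B t : slotted B -> 0 < t -> exists M,
  \forall u \near t, \sum_(m < M) B m u = glue B u.
Proof.
move=> sB t0; have [M Mt] := pow2_large t0; exists M.
have : \forall u \near t, (2 ^+ M)^-1 < u.
  by apply: lt_nbhsr; rewrite -div1r ltr_pdivrMr ?pow2_gt0// mulrC.
apply: filterS => u Mu; rewrite (@glue_fin _ M)//.
by rewrite -ler_pdivrMl ?pow2_gt0// mulr1 ltW.
Qed.

Lemma slotN_le0 m t : t <= 0 -> ~~ slot m t.
Proof. by move=> t0; apply/negP => /slot_gt0; rewrite ltNge t0. Qed.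

Lemma glue_le0 B t : slotted B -> t <= 0 -> glue B t = 0.
Proof. by move=> sB t0; apply: glue_out => // m; exact: slotN_le0. Qed.

Lemma glue_near_neg B t : slotted B -> t < 0 ->
  \forall u \near t, 0 = glue B u.
Proof.
move=> sB t0; have : \forall u \near t, u < 0 by exact: lt_nbhsl.
by apply: filterS => u /ltW u0; rewrite glue_le0.
Qed.

(* Only slots of large index come close to [0]. *)
Lemma glue_near0 B (c : R -> R) : slotted B ->
  (forall t, 0 <= c t) ->
  (\forall m \near \oo, forall t, slot m t -> `|B m t| <= c t) ->
  \forall t \near 0, `|glue B t| <= c t.
Proof.
move=> sB c0 [M _ BM]; near=> t.
have [[m mt]|H] := slot_dec t; last by rewrite glue_out// normr0.
rewrite (glue_in sB mt); apply: (BM m) => //=.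
have t0 := slot_gt0 mt; have /slotP[m1 _] := mt.
rewrite leqNgt; apply/negP => mM.
have : t < (2 ^+ M)^-1.
  by near: t; apply: lt_nbhsl; rewrite invr_gt0 pow2_gt0.
rewrite -(ltr_pM2l (pow2_gt0 M)) mulfV ?gt_eqF ?pow2_gt0//.
apply/negP; rewrite -leNgt (le_trans (ltW m1))//.
by rewrite ler_pM2r// ler_eXn2l// ltr1n.
Unshelve. all: by end_near. Qed.

Lemma near_eps_le eps e : eps @ \oo --> (0 : R) -> 0 < e ->
  \forall m \near \oo, eps m <= e.
Proof.
move=> /cvgrPdist_le eps0 e0; have := eps0 _ e0; apply: filterS => m.
by rewrite sub0r normrN; apply: le_trans; exact: ler_norm.
Qed.

(** The bounds [eps] serve only at 0, where infinitely many slots come close. *)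
Lemma glue_continuous B eps : slotted B -> (forall m, continuous (B m)) ->
  (forall m t, `|B m t| <= eps m) -> eps @ \oo --> (0 : R) ->
  continuous (glue B).
Proof.
move=> sB cB Be eps0 t; have [t0|t0|->] := ltgtP t 0.
- rewrite /continuous_at (glue_le0 sB (ltW t0)).
  apply: cvg_near_cst; have := glue_near_neg sB t0.
  by apply: filterS => u <-.
- have [M HM] := glue_near_pos sB t0.
  rewrite /continuous_at -(nbhs_singleton HM).
  have cS : continuous (fun u => \sum_(m < M) B m u).
    by apply: continuous_big => [|i _]; [exact: add_continuous|exact: cB].
  exact: cvg_trans (near_eq_cvg HM) (cS t).
- apply/cvgrPdist_le => e e0; rewrite (glue_le0 sB (lexx 0)).
  have : \forall t \near 0, `|glue B t| <= e.
    apply: (@glue_near0 _ (cst e)) => // [u|]; first exact: ltW.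
    have := near_eps_le eps0 e0; apply: filterS => m me u _.
    exact: le_trans (Be m u) me.
  by apply: filterS => u; rewrite sub0r normrN.
Qed.

(** At 0 the derivative is 0: in slot [m] one has t > 2^-(m+1), so the bound on [B m] is at most
    [eps m * t]. *)
Lemma glue_derive B D eps : slotted B -> slotted D ->
  (forall m t, is_derive t 1 (B m) (D m t)) ->
  (forall m t, `|B m t| <= eps m / 2 ^+ m.+1) -> eps @ \oo --> (0 : R) ->
  forall t, is_derive t 1 (glue B) (glue D t).
Proof.
move=> sB sD dB Be eps0 t; have [t0|t0|->] := ltgtP t 0.
- rewrite (glue_le0 sD (ltW t0)).
  exact: near_eq_is_derive (glue_near_neg sB t0) (is_derive_cst _ _ _).
- have [M Mt] := pow2_large t0.
  rewrite (@glue_fin _ M) ?ltW//.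
  have := @is_derive_sum _ _ _ M (fun i => B i) t 1 (fun i => D i t)
    (fun i => dB i t).
  apply: near_eq_is_derive.
  have : \forall u \near t, (2 ^+ M)^-1 < u.
    by apply: lt_nbhsr; rewrite -div1r ltr_pdivrMr ?pow2_gt0// mulrC.
  apply: filterS => u Mu; rewrite fct_sumE (@glue_fin _ M)//.
  by rewrite -ler_pdivrMl ?pow2_gt0// mulr1 ltW.
- rewrite (glue_le0 sD (lexx 0)); apply/is_derive1P => e e0.
  have : \forall t \near 0, `|glue B t| <= e * `|t|.
    apply: (@glue_near0 _ (fun t => e * `|t|)) => // [u|].
      by rewrite mulr_ge0// ltW.
    have := near_eps_le eps0 e0; apply: filterS => m me u mu.
    have u0 := slot_gt0 mu; have /slotP[m1 _] := mu.
    apply: (le_trans (Be m u)); rewrite gtr0_norm//.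
    rewrite ler_pdivrMr ?pow2_gt0// -mulrA (le_trans me)// ler_peMr ?ltW//.
    by rewrite mulrC.
  by apply: filterS => u; rewrite (glue_le0 sB (lexx 0)) mul0r !subr0.
Qed.

(** The denominator is the slope of [coord m], so that differentiating a scaled profile gives the
    derivative of the profile with no extra factor. *)
Definition scaled k m t := k m (coord m t) / (8 * 2 ^+ m).
Definition dscaled k m t := k m (coord m t).

Lemma slotted_scaled k :
  (forall m s, 2 <= `|s| -> k m s = 0) -> slotted (scaled k).
Proof. by move=> k0 m t; rewrite -leNgt => /k0 k1; rewrite /scaled k1 mul0r. Qed.

Lemma slotted_dscaled k :
  (forall m s, 2 <= `|s| -> k m s = 0) -> slotted (dscaled k).
Proof. by move=> k0 m t; rewrite -leNgt; exact: k0. Qed.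

Lemma is_derive_coord m t : is_derive t 1 (coord m) (8 * 2 ^+ m).
Proof.
rewrite (_ : coord m = (8 * 2 ^+ m) *: id - cst 6); last first.
  by apply/funext => u; rewrite /coord !fctE /GRing.scale /= mulrA.
by apply: is_derive_eq; rewrite subr0 /GRing.scale /= mulr1.
Qed.

Lemma is_derive_scaled k (dk : nat -> R -> R) m t :
  (forall s, is_derive s 1 (k m) (dk m s)) ->
  is_derive t 1 (scaled k m) (dscaled dk m t).
Proof.
move=> kd.
rewrite (_ : scaled k m = (8 * 2 ^+ m)^-1 *: (k m \o coord m)); last first.
  by apply/funext => u; rewrite /scaled fctE /GRing.scale /= mulrC.
have ? := is_derive_coord m t; have ? := kd (coord m t).
apply: is_derive_eq; rewrite /dscaled /GRing.scale /=.
by field; rewrite gt_eqF ?pow2_gt0.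
Qed.

End glueing.

(** * From the line to Diff([0,1]) *)

Section diffeomorphisms.
Context {R : realType}.
Implicit Types (x y : I01 R) (h d : I01 R -> R).

Lemma I01_itv x : 0 <= \val x <= 1.
Proof. by have := set_valP x; rewrite /I01 /= in_itv. Qed.

Lemma I01_lift (t : R) : 0 <= t <= 1 -> exists x : I01 R, \val x = t.
Proof.
move=> t01; have tI : t \in I01 R by rewrite inE /I01 /= in_itv.
by exists (exist _ t tI).
Qed.

Lemma continuous_val01 : continuous (fun x => \val x).
Proof. exact: initial_continuous. Qed.

Lemma nbhs_I01 x (P : set (I01 R)) :
  (exists2 e : R, 0 < e & forall y, `|\val x - \val y| < e -> P y) ->
  \forall y \near x, P y.
Proof. by move=> [e e0 eP]; apply/nbhs_ballP; exists e => //= y; exact: eP. Qed.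

Lemma continuous_I01P h : (forall x e, 0 < e -> exists2 r : R, 0 < r & forall y,
  `|\val x - \val y| < r -> `|h x - h y| <= e) -> continuous h.
Proof.
move=> H x; apply/(@cvgrPdist_le _ _ _ (nbhs x) (nbhs_filter x)) => e e0.
apply: nbhs_I01.
by have [r r0 rP] := H x e e0; exists r.
Qed.

Lemma continuous_to_I01 (f : I01 R -> I01 R) :
  continuous (fun x => \val (f x)) -> continuous f.
Proof. by move=> cf; apply/continuous_comp_initial. Qed.

Lemma diffquot01_cvg (u : R -> R) (a : R) x : is_derive (\val x) 1 u a ->
  diffquot01 (fun y => u (\val y)) x @ x^' --> a.
Proof.
move=> /is_derive1P ua; apply/(@cvgrPdist_le _ _ _ _ (dnbhs_filter x)) => e e0.
rewrite near_withinE.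
have /nbhs_ballP[r /= r0 rP] := ua _ e0.
apply: nbhs_I01; exists r => // y xy yx.
have yx0 : \val y - \val x != 0 by rewrite subr_eq0 val_eqE.
rewrite /diffquot01 -(ler_pM2r (_ : 0 < `|\val y - \val x|)) ?normr_gt0//.
rewrite -normrM mulrBl divfK// distrC; exact: rP.
Qed.

Lemma derive01_eq h d :
  (forall x, diffquot01 h x @ x^' --> d x) -> derive01 h = d.
Proof.
move=> hd; apply/funext => x; have := I01_dnbhs_proper x => ?.
by apply: cvg_lim; [exact: Rhausdorff | exact: hd].
Qed.

Lemma C1_01_of h d : (forall x, diffquot01 h x @ x^' --> d x) ->
  continuous d -> C1_01 h.
Proof.
move=> hd cd; split=> [x|]; first by apply/cvg_ex; exists (d x); exact: hd.
by rewrite (derive01_eq hd).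
Qed.

(** The difference quotient of the inverse is the reciprocal of that of [f] taken along [fi], and
    [fi], being continuous and injective, respects punctured neighbourhoods. *)
Lemma diffquot01_inv (f fi : I01 R -> I01 R) d : cancel f fi -> cancel fi f ->
  continuous fi -> (forall x, d x != 0) ->
  (forall x, diffquot01 (fun t => \val (f t)) x @ x^' --> d x) ->
  forall y, diffquot01 (fun t => \val (fi t)) y @ y^' --> (d (fi y))^-1.
Proof.
move=> fK fiK cfi d0 fd y.
have -> : diffquot01 (fun t => \val (fi t)) y =
    fun z => ((diffquot01 (fun t => \val (f t)) (fi y) \o fi) z)^-1.
  by apply/funext => z; rewrite /diffquot01 /= !fiK invf_div.
apply: cvgV => //; apply: cvg_comp (fd (fi y)).
move=> P nP; have := cfi y (fun z => z != fi y -> P z) nP.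
apply: (@filterS _ (nbhs y) (nbhs_filter y)) => z /= Pz zy.
by apply: Pz; apply: contra_neq zy => /(can_inj fiK).
Qed.

(** By the mean value theorem, [u] expands distances by at least the factor [a]: this gives strict
    monotonicity and a Lipschitz inverse. Surjectivity onto [0, 1] comes from intermediate
    values. *)
Lemma exists_diff01 (u D : R -> R) (a : R) :
  (forall t : R, is_derive t 1 u (D t)) ->
  continuous D -> 0 < a -> (forall t, a <= D t) -> u 0 = 0 -> u 1 = 1 ->
  exists f : diff01 R, forall x, \val (f x) = u (\val x) /\
    diff01_derive f x = D (\val x).
Proof.
move=> uD cD a0 aD u0 u1.
have cu := is_derive_continuous uD.
have mono s t : s < t -> a * (t - s) <= u t - u s.
  move=> st; have [|c _ ->] := MVT st (fun z _ => uD z).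
    exact/continuous_subspaceT.
  by rewrite ler_pM2r ?subr_gt0.
have incr s t : s < t -> u s < u t.
  move=> st; rewrite -subr_gt0 (lt_le_trans _ (mono _ _ st))//.
  by rewrite mulr_gt0// subr_gt0.
have absmono s t : a * `|s - t| <= `|u s - u t|.
  wlog st : s t / s < t.
    move=> H; have [/H//|/H|->] := ltgtP s t; last by rewrite !subrr normr0 mulr0.
    by rewrite distrC [`|u t - _|]distrC.
  rewrite distrC [`|u s - _|]distrC !gtr0_norm ?subr_gt0 ?incr//; exact: mono.
have incrW s t : s <= t -> u s <= u t.
  by rewrite le_eqVlt => /predU1P[->//|/incr/ltW].
have inj s t : u s = u t -> s = t.
  by move=> ust; have [/incr|/incr|] := ltgtP s t; rewrite ?ust ?ltxx.
have /choice[f fE] : forall x, exists y, \val y = u (\val x).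
  move=> x; apply: I01_lift; have /andP[x0 x1] := I01_itv x.
  by rewrite -{1}u0 -{1}u1 !incrW.
have /choice[fi fiE] : forall y, exists x, u (\val x) = \val y.
  move=> y; have yI := I01_itv y.
  have [||t tI ut] := @IVT R u 0 1 (\val y) ler01.
  - exact: continuous_subspaceT.
  - by rewrite u0 u1 min_l ?ler01// max_r ?ler01.
  - have [|x xt] := @I01_lift t; first by move: tI; rewrite in_itv.
    by exists x; rewrite xt.
have fK : cancel f fi by move=> x; apply/val_inj/inj; rewrite fiE fE.
have fiK : cancel fi f by move=> x; apply/val_inj; rewrite fE fiE.
have cf : continuous f.
  apply: continuous_to_I01; rewrite (_ : (fun x => _) = u \o (fun x => \val x)).
    by move=> x; apply: continuous_comp; [exact: continuous_val01|exact: cu].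
  by apply/funext.
have cfi : continuous fi.
  apply: continuous_to_I01; apply: continuous_I01P => x e e0.
  exists (a * e); first exact: mulr_gt0.
  move=> y /ltW xy; rewrite -(ler_pM2l a0); apply: le_trans xy.
  by rewrite -(fiE x) -(fiE y); exact: absmono.
have fd x : diffquot01 (fun t => \val (f t)) x @ x^' --> D (\val x).
  by under eq_fun do rewrite fE; exact: diffquot01_cvg.
have D0 t : D t != 0 by rewrite gt_eqF// (lt_le_trans a0).
have cD01 : continuous (fun x : I01 R => D (\val x)).
  by move=> x; apply: continuous_comp; [exact: continuous_val01|exact: cD].
have fC1 : C1_01 (fun t => \val (f t)) by exact: C1_01_of fd cD01.
have fiC1 : C1_01 (fun t => \val (fi t)).
  apply: (C1_01_of (diffquot01_inv fK fiK cfi _ fd)) => // y.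
  have cDi : continuous (fun t : R => (D t)^-1).
    by move=> t; apply: cvgV => //; exact: cD.
  have cvfi : {for y, continuous (fun z => \val (fi z))}.
    exact: continuous_comp (cfi y) (@continuous_val01 _).
  exact: continuous_comp cvfi (cDi _).
have fincr s t : \val s < \val t -> \val (f s) < \val (f t).
  by rewrite !fE; exact: incr.
exists (@Diff01 R (Homeo01 fK fiK fincr cf cfi) fC1 fiC1) => x; split=> //.
by rewrite /diff01_derive (derive01_eq fd).
Qed.

End diffeomorphisms.

(** * Diffeomorphisms obtained by perturbing the identity in each slot *)

Section perturbations.
Context {R : realType}.
Implicit Types (t s : R) (m : nat) (k dk : nat -> R -> R) (eps z d : nat -> R).

Definition perturb k t := t + glue (scaled k) t.
Definition dperturb dk t := 1 + glue (dscaled dk) t.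

Definition vanishing k := forall m s, 2 <= `|s| -> k m s = 0.

Lemma perturb_in k m t : vanishing k -> slot m t ->
  perturb k t = uncoord m (coord m t + k m (coord m t)).
Proof.
move=> k0 mt; rewrite /perturb (glue_in (slotted_scaled k0) mt).
rewrite /scaled /uncoord -{1}(coordK m t) /uncoord -mulrDl.
by congr (_ / _); ring.
Qed.

Lemma perturb_out k t : vanishing k ->
  (forall m, ~~ slot m t) -> perturb k t = t.
Proof.
by move=> k0 H; rewrite /perturb glue_out ?addr0//; exact: slotted_scaled.
Qed.

(** Since [eps] is at most 1/2, the derivative stays above 1/2; since [eps] tends to 0, it is
    continuous at 0. The endpoints 0 and 1 lie in no slot, hence are fixed. *)
Lemma perturb_diff01 k dk eps : vanishing k -> vanishing dk ->
  (forall m s, is_derive s 1 (k m) (dk m s)) -> (forall m, continuous (dk m)) ->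
  (forall m s, `|k m s| <= eps m) -> (forall m s, `|dk m s| <= eps m) ->
  (forall m, eps m <= 2^-1) -> eps @ \oo --> (0 : R) ->
  exists f : diff01 R, forall x, \val (f x) = perturb k (\val x) /\
    diff01_derive f x = dperturb dk (\val x).
Proof.
move=> k0 dk0 kd cdk ke dke eps2 eps0.
have sk := slotted_scaled k0; have sdk := slotted_dscaled dk0.
apply: (@exists_diff01 _ _ _ 2^-1) => //.
- move=> t; apply: is_deriveD; apply: glue_derive eps0 _ => //.
    by move=> m u; exact: is_derive_scaled.
  move=> m u; rewrite /scaled normrM.
  rewrite [`|_^-1|]gtr0_norm ?invr_gt0 ?mulr_gt0 ?pow2_gt0//.
  have e0 : 0 <= eps m := le_trans (normr_ge0 _) (ke m 0).
  rewrite ler_pM// lef_pV2 ?posrE ?mulr_gt0 ?pow2_gt0// exprS ler_pM2r ?pow2_gt0//.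
  by rewrite ler_nat.
- move=> t; apply: cvgD; first exact: cvg_cst.
  apply: glue_continuous eps0 _ => // m; last by move=> u; exact: dke.
  move=> u; apply: continuous_comp; last exact: cdk.
  exact: (is_derive_continuous (is_derive_coord m)).
- move=> t; rewrite /dperturb.
  suff : `|glue (dscaled dk) t| <= 2^-1 by rewrite ler_norml => /andP[? _]; lra.
  have [[m mt]|H] := slot_dec t; last by rewrite glue_out// normr0 invr_ge0.
  by rewrite (glue_in sdk mt) (le_trans (dke _ _)).
- by apply: perturb_out => // m; exact: slotN_le0.
- by apply: perturb_out => // m; apply/negP => /slot_lt1; rewrite ltxx.
Qed.

(** In slot coordinates the bump has centre [z m / 8] and half-width 1/2. For [z m] in [0, 1] it
    therefore stays well inside [-1, 1], where [plateau] is 1. *)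
Definition moving_bump z m s := (16 * 2 ^+ m)^-1 * bump (2 * (s - z m / 8)).
Definition dmoving_bump z m s := (8 * 2 ^+ m)^-1 * dbump (2 * (s - z m / 8)).
(** The resulting perturbation translates by [d m] on the plateau and tapers off to the identity at
    the ends of the slot. *)
Definition shift_step d m s := d m * plateau s.
Definition dshift_step d m s := d m * dplateau s.

Definition unit_valued z := forall m, 0 <= z m <= 1.

Lemma moving_far z m s : unit_valued z ->
  1 <= `|s| -> 1 <= `|2 * (s - z m / 8)|.
Proof.
move=> /(_ m)/andP[z0 z1]; rewrite !ler_normr.
by case/orP => s2; apply/orP; [left|right]; lra.
Qed.

Lemma vanishing_moving_bump z : unit_valued z -> vanishing (moving_bump z).
Proof.
move=> zu m s s2; rewrite /moving_bump bump_out ?mulr0//.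
by rewrite moving_far// (le_trans _ s2)// ler1n.
Qed.

Lemma vanishing_dmoving_bump z : unit_valued z -> vanishing (dmoving_bump z).
Proof.
move=> zu m s s2; rewrite /dmoving_bump dbump_out ?mulr0//.
by rewrite moving_far// (le_trans _ s2)// ler1n.
Qed.

Lemma vanishing_shift_step d : vanishing (shift_step d).
Proof. by move=> m s s2; rewrite /shift_step plateau_out ?mulr0. Qed.

Lemma vanishing_dshift_step d : vanishing (dshift_step d).
Proof. by move=> m s s2; rewrite /dshift_step dplateau_out ?mulr0. Qed.

Lemma is_derive_shift_step d m s :
  is_derive s 1 (shift_step d m) (dshift_step d m s).
Proof. by have ? := is_derive_plateau s; exact: is_deriveZ. Qed.

Lemma is_derive_moving_bump z m s :
  is_derive s 1 (moving_bump z m) (dmoving_bump z m s).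
Proof.
rewrite (_ : moving_bump z m =
    (16 * 2 ^+ m)^-1 *: (bump \o (2 *: (id - cst (z m / 8))))); last first.
  by apply/funext => u; rewrite /moving_bump !fctE.
have ? := is_derive_bump ((2 *: (id - cst (z m / 8))) s).
apply: is_derive_eq; rewrite /dmoving_bump !fctE /GRing.scale /=.
by field; rewrite gt_eqF ?pow2_gt0.
Qed.

Lemma pow2V_cvg0 : (fun m => (2 * 2 ^+ m)^-1) @ \oo --> (0 : R).
Proof.
rewrite (_ : (fun m => _) = (fun m => 2^-1 * 2^-1 ^+ m)); last first.
  by apply/funext => m; rewrite invfM exprVn.
rewrite -(mulr0 2^-1); apply: cvgM; first exact: cvg_cst.
by apply: cvg_expr; rewrite gtr0_norm ?invr_gt0// invf_lt1// ltr1n.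
Qed.

Lemma pow2V_ge0 (c : R) m : 0 <= c -> 0 <= (c * 2 ^+ m)^-1.
Proof. by move=> c0; rewrite invr_ge0 mulr_ge0// ltW ?pow2_gt0. Qed.

Lemma ler_pow2V (a b : R) m : 0 < a -> a <= b ->
  (b * 2 ^+ m)^-1 <= (a * 2 ^+ m)^-1.
Proof.
move=> a0 ab; have b0 := lt_le_trans a0 ab.
by rewrite lef_pV2 ?posrE ?mulr_gt0 ?pow2_gt0// ler_pM2r ?pow2_gt0.
Qed.

Lemma moving_bump_ge0 z m s : 0 <= moving_bump z m s.
Proof. by rewrite mulr_ge0 ?bump_ge0// pow2V_ge0. Qed.

Lemma moving_bump_le16 z m s : moving_bump z m s <= (16 * 2 ^+ m)^-1.
Proof. by rewrite ler_piMr ?bump_le1// pow2V_ge0. Qed.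

Lemma moving_bump_le z m s : `|moving_bump z m s| <= (2 * 2 ^+ m)^-1.
Proof.
rewrite ger0_norm ?moving_bump_ge0// (le_trans (moving_bump_le16 _ _ _))//.
by rewrite ler_pow2V// ler_nat.
Qed.

Lemma dmoving_bump_le z m s : `|dmoving_bump z m s| <= (2 * 2 ^+ m)^-1.
Proof.
rewrite /dmoving_bump normrM gtr0_norm ?invr_gt0 ?mulr_gt0 ?pow2_gt0//.
rewrite (_ : (2 * 2 ^+ m)^-1 = (8 * 2 ^+ m)^-1 * 4); last first.
  by field; rewrite gt_eqF ?pow2_gt0.
by rewrite ler_pM2l ?dbump_le// invr_gt0 mulr_gt0 ?pow2_gt0.
Qed.

Lemma exists_bump_diff01 z : unit_valued z ->
  exists f : diff01 R, forall x,
    \val (f x) = perturb (moving_bump z) (\val x) /\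
    diff01_derive f x = dperturb (dmoving_bump z) (\val x).
Proof.
move=> zu; apply: (@perturb_diff01 _ _ (fun m => (2 * 2 ^+ m)^-1)).
- exact: vanishing_moving_bump.
- exact: vanishing_dmoving_bump.
- exact: is_derive_moving_bump.
- move=> m; rewrite /dmoving_bump => s; apply: cvgM; first exact: cvg_cst.
  have cu : {for s, continuous (fun s : R => 2 * (s - z m / 8))}.
    apply: cvgM; first exact: cvg_cst.
    by apply: cvgB => //; exact: cvg_cst.
  exact: continuous_comp cu (@continuous_dbump _ _).
- exact: moving_bump_le.
- exact: dmoving_bump_le.
- move=> m; rewrite lef_pV2 ?posrE ?mulr_gt0 ?pow2_gt0//.
  by rewrite ler_peMr// exprn_ege1// ler1n.
- exact: pow2V_cvg0.
Qed.

Lemma exists_shift_diff01 d : (forall m, `|d m| <= 8^-1) ->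
  d @ \oo --> (0 : R) ->
  exists g : diff01 R, forall x, \val (g x) = perturb (shift_step d) (\val x).
Proof.
move=> d8 d0.
suff [g gE] : exists g : diff01 R, forall x,
    \val (g x) = perturb (shift_step d) (\val x) /\
    diff01_derive g x = dperturb (dshift_step d) (\val x).
  by exists g => x; have [] := gE x.
(* The factor 4 bounds [dplateau]; together with the bound 1/8 on the shifts it gives the required
   1/2. *)
apply: (@perturb_diff01 _ _ (fun m => 4 * `|d m|)).
- exact: vanishing_shift_step.
- exact: vanishing_dshift_step.
- exact: is_derive_shift_step.
- move=> m s; apply: cvgM; [exact: cvg_cst | exact: continuous_dplateau].
- move=> m s; rewrite /shift_step normrM mulrC ler_wpM2r//.
  by rewrite ger0_norm ?plateau_ge0// (le_trans (plateau_le1 _))// ler1n.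
- by move=> m s; rewrite /dshift_step normrM mulrC ler_wpM2r// dplateau_le.
- by move=> m; have := d8 m; lra.
- rewrite -(mulr0 4); apply: cvgM; first exact: cvg_cst.
  by rewrite -(@normr0 _ R); exact: cvg_norm.
Qed.

(* In a slot, the bump moves inside the plateau of the shift, where the shift
   is a translation carrying the bump of [z] to that of [z']. *)
Lemma perturb_conj z z' t : unit_valued z -> unit_valued z' ->
  let g := perturb (shift_step (fun m => (z' m - z m) / 8)) in
  g (perturb (moving_bump z) t) = perturb (moving_bump z') (g t).
Proof.
move=> zu zu' /=; set d := fun m => _.
have vz := vanishing_moving_bump zu; have vz' := vanishing_moving_bump zu'.
have vd := vanishing_shift_step d.
have [[m mt]|H] := slot_dec t; last by rewrite !perturb_out.
rewrite (perturb_in vz mt) (perturb_in vd mt).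
have mE s : `|s| < 2 -> slot m (uncoord m s) by rewrite /slot uncoordK.
set s := coord m t; have s2 : `|s| < 2 by [].
have /andP[z0 z1] := zu m; have /andP[z0' z1'] := zu' m.
have [s1|s1] := leP `|s| 1.
  have p1 : plateau s = 1 by exact: plateau_in.
  (* The moved point is still on the plateau: inside the bump s is below 1/8 + 1/2, and the bump
     adds at most 1/16. *)
  have q1 : `|s + moving_bump z m s| <= 1.
    have [far|near] := leP 1 `|2 * (s - z m / 8)|.
      by rewrite /moving_bump bump_out// mulr0 addr0.
    have b0 := moving_bump_ge0 z m s.
    have b1 : moving_bump z m s <= 16^-1.
      rewrite (le_trans (moving_bump_le16 _ _ _))//.
      rewrite lef_pV2 ?posrE ?mulr_gt0 ?pow2_gt0//.
      by rewrite ler_peMr// exprn_ege1// ler1n.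
    move: near s1; rewrite ltr_norml !ler_norml => /andP[? ?] /andP[? ?].
    by apply/andP; split; lra.
  rewrite (@perturb_in _ m _ vd) ?uncoordK; last first.
    by apply: mE; rewrite (le_lt_trans q1)// ltr1n.
  rewrite (@perturb_in _ m _ vz') ?uncoordK; last first.
    apply: mE; rewrite /shift_step p1 mulr1 /d.
    by move: s1; rewrite ler_norml ltr_norml => /andP[? ?]; apply/andP; split; lra.
  rewrite /shift_step p1 plateau_in// mulr1 /moving_bump.
  rewrite (_ : s + d m - z' m / 8 = s - z m / 8); last by rewrite /d; field.
  by rewrite addrAC.
(* Off the plateau the bump of [z] vanishes, so the two sides agree as soon as the shifted point
   misses the bump of [z']. It does, because the shift is at most 1/8 and |s| > 1. *)
have -> : moving_bump z m s = 0.
  by rewrite /moving_bump bump_out ?mulr0//; apply: moving_far => //; exact: ltW.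
rewrite addr0 /s coordK (perturb_in vd mt) -/s.
have p0 := plateau_ge0 s; have p1 := plateau_le1 s.
have dp : `|shift_step d m s| <= 8^-1 * plateau s.
  rewrite normrM (ger0_norm p0) ler_wpM2r// /d ler_norml.
  by apply/andP; split; lra.
(* The shift is thus at most a quarter of the distance from |s| to 2, and the shifted point stays in
   the slot. *)
have p2 : plateau s <= 2 * (2 - `|s|) by rewrite plateau_le// ltW.
have s2' : `|s + shift_step d m s| < 2.
  by rewrite (le_lt_trans (ler_normD _ _))//; lra.
rewrite (@perturb_in _ m _ vz') ?uncoordK; last exact: mE.
rewrite [moving_bump _ _ _](_ : _ = 0) ?addr0//.
rewrite /moving_bump bump_out ?mulr0//.
move: dp; rewrite ler_norml => /andP[? ?].
move: s1; rewrite lter_normr ler_normr => /orP[] ?; apply/orP; [left|right]; lra.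
Qed.

End perturbations.

(** * Rigidity of the moved set *)

Section order_rigidity.
Context {R : realType}.
Implicit Types (S : set (I01 R)) (a b : nat -> I01 R) (x y : I01 R).

(** The intervals ]a m, b m[ are the order components of [S], listed downwards. Neighbours may share
    an endpoint, which is then outside [S]. The existence of a topmost component starts the
    induction of [ladder_conj]. *)
Record ladder S a b : Prop := Ladder {
  ladder_lt : forall m, \val (a m) < \val (b m) ;
  ladder_next : forall m, \val (b m.+1) <= \val (a m) ;
  ladder_in : forall m x, \val (a m) < \val x < \val (b m) -> S x ;
  ladder_out : forall x, S x -> exists m, \val (a m) < \val x < \val (b m) }.

Lemma ladder_b S a b : ladder S a b ->
  {homo (\val \o b) : m n / (m <= n)%N >-> n <= m}.
Proof.
move=> L m n /subnK <-; elim: (n - m)%N => [|k IH] //=.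
rewrite addSn (le_trans _ IH)// (le_trans (ladder_next L _))// ltW//.
exact: ladder_lt L _.
Qed.

Lemma ladder_a S a b : ladder S a b ->
  {homo (\val \o a) : m n / (m <= n)%N >-> n <= m}.
Proof.
move=> L m n /subnK <-; elim: (n - m)%N => [|k IH] //=.
rewrite addSn (le_trans _ IH)// (le_trans (ltW (ladder_lt L _)))//.
exact: ladder_next L _.
Qed.

Lemma ladder_top S a b x : ladder S a b -> \val (b 0) <= \val x -> ~ S x.
Proof.
move=> L bx /(ladder_out L)[m /andP[_ xb]].
by have := lt_le_trans xb (ladder_b L (leq0n m)); rewrite ltNge bx.
Qed.

Lemma ladder_gap S a b m x : ladder S a b ->
  \val (b m.+1) <= \val x <= \val (a m) -> ~ S x.
Proof.
move=> L /andP[bx xa] /(ladder_out L)[n /andP[ax xb]].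
have [nm|mn] := leqP n m.
  by have := lt_le_trans ax xa; rewrite ltNge (ladder_a L nm).
by have := lt_le_trans xb (ladder_b L mn); rewrite ltNge bx.
Qed.

Lemma I01_between x x' y : \val x < \val y -> \val x' < \val y ->
  exists w : I01 R, [/\ \val x < \val w, \val x' < \val w & \val w < \val y].
Proof.
move=> xy xy'; have /andP[x0 _] := I01_itv x; have /andP[_ y1] := I01_itv y.
have [|w wE] := @I01_lift R ((Num.max (\val x) (\val x') + \val y) / 2).
  by case: (leP (\val x)) => ?; apply/andP; split; lra.
by exists w; rewrite wE; case: (leP (\val x)) => ?; split; lra.
Qed.

Definition increasing01 (g : I01 R -> I01 R) :=
  forall x y, \val x < \val y -> \val (g x) < \val (g y).

Section conjugated_ladders.
Variables (S S' : set (I01 R)) (a b a' b' : nat -> I01 R).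
Variables (g h : I01 R -> I01 R).
Hypotheses (gK : cancel g h) (hK : cancel h g).
Hypotheses (gi : increasing01 g) (hi : increasing01 h).
Hypotheses (SS' : forall x, S x <-> S' (g x)).
Hypotheses (L : ladder S a b) (L' : ladder S' a' b').

(** Points of [S] approach [b m] from below, and those close enough to it still have their image
    above [b' m]. Such an image contradicts the absence of points of S' above [b' 0], or in the gap
    above [b' m]. *)
Lemma ladder_above m : \val (b' m) < \val (g (b m)) ->
  exists w, [/\ \val (b' m) < \val (g w), \val w < \val (b m) & S' (g w)].
Proof.
move=> /hi; rewrite gK => hb.
have [w [aw hw wb]] := I01_between (ladder_lt L m) hb.
exists w; split=> //; first by rewrite -(hK (b' m)); exact: gi.
by apply/SS'/(ladder_in L (m := m)); rewrite aw wb.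
Qed.

Lemma ladder_le_b0 : \val (g (b 0)) <= \val (b' 0).
Proof.
rewrite leNgt; apply/negP => /ladder_above[w [bw _]].
exact: ladder_top L' (ltW bw).
Qed.

(** Otherwise [g (a m)] would fall inside the [m]-th component of S', although [a m] is outside
    [S]. *)
Lemma ladder_le_a m : g (b m) = b' m -> \val (g (a m)) <= \val (a' m).
Proof.
move=> gb; rewrite leNgt; apply/negP => ag.
have /SS' : S' (g (a m)).
  by apply: (ladder_in L' (m := m)); rewrite ag -gb gi// (ladder_lt L).
by apply: (ladder_gap (m := m) L); rewrite lexx (ladder_next L).
Qed.

Lemma ladder_le_b m : g (a m) = a' m -> \val (g (b m.+1)) <= \val (b' m.+1).
Proof.
move=> ga; rewrite leNgt; apply/negP => /ladder_above[w [bw wb]].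
apply: (ladder_gap (m := m) L'); rewrite (ltW bw) -ga ltW// gi//.
exact: lt_le_trans wb (ladder_next L m).
Qed.

End conjugated_ladders.

(* An increasing conjugacy carries the top component to the top component,
   then the next one to the next one, and so on. *)
Lemma ladder_conj S S' a b a' b' (g h : I01 R -> I01 R) :
  cancel g h -> cancel h g -> increasing01 g -> increasing01 h ->
  (forall x, S x <-> S' (g x)) -> ladder S a b -> ladder S' a' b' ->
  forall m, g (a m) = a' m.
Proof.
move=> gK hK gi hi SS' L L'.
have S'S x : S' x <-> S (h x) by rewrite SS' hK.
(* The preceding lemmas give only upper bounds; applying them to [g] and, with the two ladders
   exchanged, to [h] gives equality. *)
have both x y : \val (g x) <= \val y -> \val (h y) <= \val x -> g x = y.
  move=> gxy hyx; apply/val_inj/le_anti; rewrite gxy /= leNgt.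
  apply/negP => /hi.
  by rewrite gK ltNge hyx.
have stepa m : g (b m) = b' m -> g (a m) = a' m.
  move=> gb; apply: both; first exact: ladder_le_a gi SS' L L' _ gb.
  by apply: (ladder_le_a hi S'S L' L); rewrite -gb gK.
suff H m : g (b m) = b' m by move=> m; exact/stepa/H.
elim: m => [|m /stepa ga]; apply: both.
- exact: ladder_le_b0 gK hK gi hi SS' L L'.
- exact: ladder_le_b0 hK gK hi gi S'S L' L.
- exact: ladder_le_b gK hK gi hi SS' L L' _ ga.
- by apply: (ladder_le_b hK gK hi gi S'S L' L); rewrite -ga gK.
Qed.

End order_rigidity.

(** * Conjugate bump maps have asymptotically equal codes *)

Section conjugacy.
Context {R : realType}.
Implicit Types (z : nat -> R) (m : nat).

Definition bump_left z m : R := uncoord m (z m / 8 - 2^-1).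
Definition bump_right z m : R := uncoord m (z m / 8 + 2^-1).

Lemma perturb_bump_neq z m (t : R) : unit_valued z ->
  bump_left z m < t < bump_right z m -> perturb (moving_bump z) t != t.
Proof.
move=> zu; rewrite -{1 2}(coordK m t) /bump_left /bump_right /uncoord.
have /andP[z0 z1] := zu m.
have p0 : 0 < (8 * 2 ^+ m : R)^-1 by rewrite invr_gt0 mulr_gt0 ?pow2_gt0.
rewrite !(ltr_pM2r p0) !ltrD2r => /andP[ct tc].
have mt : slot m t by rewrite /slot ltr_norml; apply/andP; split; lra.
rewrite (perturb_in (vanishing_moving_bump zu) mt) -{3}(coordK m t).
rewrite (inj_eq (can_inj (uncoordK m))) -subr_eq0 addrAC subrr add0r.
rewrite gt_eqF//; apply: mulr_gt0; first by rewrite invr_gt0 mulr_gt0 ?pow2_gt0.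
by rewrite bump_gt0// ltr_norml; apply/andP; split; lra.
Qed.

Lemma perturb_bump_fix z (t : R) : unit_valued z ->
  perturb (moving_bump z) t != t ->
  exists m, bump_left z m < t < bump_right z m.
Proof.
move=> zu; have [[m mt]|H] := slot_dec t; last first.
  by rewrite (perturb_out (vanishing_moving_bump zu) H) eqxx.
rewrite (perturb_in (vanishing_moving_bump zu) mt) => neq; exists m.
have [far|] := leP 1 `|2 * (coord m t - z m / 8)|.
  by move: neq; rewrite /moving_bump bump_out// mulr0 addr0 coordK eqxx.
rewrite ltr_norml => /andP[? ?].
rewrite -(coordK m t) /bump_left /bump_right /uncoord.
have p0 : 0 < (8 * 2 ^+ m : R)^-1 by rewrite invr_gt0 mulr_gt0 ?pow2_gt0.
by rewrite !(ltr_pM2r p0) !ltrD2r; apply/andP; split; lra.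
Qed.

Lemma bump_left_gt0 z m : unit_valued z -> 0 < bump_left z m.
Proof.
move=> zu; have /andP[z0 z1] := zu m.
by rewrite divr_gt0 ?mulr_gt0 ?pow2_gt0//; lra.
Qed.

Lemma bump_left_lt_right z m : bump_left z m < bump_right z m.
Proof. by rewrite ltr_pM2r ?invr_gt0 ?mulr_gt0 ?pow2_gt0//; lra. Qed.

Lemma bump_right_le1 z m : unit_valued z -> bump_right z m <= 1.
Proof.
move=> zu; have /andP[z0 z1] := zu m.
rewrite ler_pdivrMr ?mulr_gt0 ?pow2_gt0// mul1r.
have : 1 <= 2 ^+ m :> R by rewrite exprn_ege1// ler1n.
by lra.
Qed.

Lemma bump_right_next z m : unit_valued z -> bump_right z m.+1 <= bump_left z m.
Proof.
move=> zu; have /andP[z0 z1] := zu m; have /andP[w0 w1] := zu m.+1.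
rewrite /bump_right /bump_left /uncoord exprS.
rewrite ler_pdivrMr ?mulr_gt0 ?pow2_gt0// mulrAC.
rewrite ler_pdivlMr ?mulr_gt0 ?pow2_gt0//.
by have := pow2_gt0 (R := R) m; nra.
Qed.

Lemma bump_ladder z (f : I01 R -> I01 R) : unit_valued z ->
  (forall x, \val (f x) = perturb (moving_bump z) (\val x)) ->
  exists a b, [/\ ladder [set x | f x != x] a b &
    forall m, \val (a m) = bump_left z m].
Proof.
move=> zu fE.
have /choice[a aE] : forall m, exists x : I01 R, \val x = bump_left z m.
  move=> m; apply: I01_lift; rewrite ltW ?bump_left_gt0//=.
  by rewrite ltW// (lt_le_trans (bump_left_lt_right z m))// bump_right_le1.
have /choice[b bE] : forall m, exists x : I01 R, \val x = bump_right z m.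
  move=> m; apply: I01_lift; rewrite bump_right_le1// andbT ltW//.
  by rewrite (lt_trans (bump_left_gt0 m zu))// bump_left_lt_right.
exists a, b; split=> //; split=> [m|m|m x|x]; rewrite ?aE ?bE.
- exact: bump_left_lt_right.
- exact: bump_right_next.
- by move=> /(perturb_bump_neq zu); rewrite /= -val_eqE fE.
- rewrite /= -val_eqE fE => /(perturb_bump_fix zu)[m mx].
  by exists m; rewrite aE bE.
Qed.

Lemma conj_bump_cvg z z' (f f' g : diff01 R) :
  unit_valued z -> unit_valued z' ->
  (forall x, \val (f x) = perturb (moving_bump z) (\val x)) ->
  (forall x, \val (f' x) = perturb (moving_bump z') (\val x)) ->
  (forall M, exists2 m, (M <= m)%N & z m = z' m) ->
  g \o f \o homeo01_inv g = f' :> (I01 R -> I01 R) ->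
  (fun m => z' m - z m) @ \oo --> (0 : R).
Proof.
move=> zu zu' fE fE' zz' gff'.
have gK := homeo01_funK g; have hK := homeo01_invK g.
have gi : increasing01 g by move=> x y; exact: homeo01_incr.
have hi : increasing01 (homeo01_inv g).
  move=> x y xy; rewrite ltNge le_eqVlt; apply/negP => /predU1P[E|/gi].
    by move: xy; rewrite -(hK x) -(hK y) (val_inj E) ltxx.
  by rewrite !hK ltNge ltW.
have [a [b [L aE]]] := bump_ladder zu fE.
have [a' [b' [L' aE']]] := bump_ladder zu' fE'.
have SS' x : [set x | f x != x] x <-> [set x | f' x != x] (g x).
  rewrite /= -gff' /= gK; split; last by apply: contra_neq => ->.
  by apply: contra_neq; exact: (can_inj gK).
have ga := ladder_conj gK hK gi hi SS' L L'.
have [p pE] : exists p : I01 R, \val p = 0.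
  by apply: I01_lift; rewrite lexx ler01.
have g_o : \val (g p) = 0.
  apply/eqP; rewrite eq_le (andP (I01_itv _)).1 andbT leNgt; apply/negP.
  rewrite -pE => /hi; rewrite gK pE ltNge.
  by rewrite (andP (I01_itv _)).1.
have [c cP] : exists c : R, diffquot01 (fun t => \val (g t)) p @ p^' --> c.
  by apply/cvg_ex; exact: (diff01_C1 g).1.
(* The left endpoints tend to 0 without reaching it, so the difference quotient of [g] at 0 may be
   evaluated along them. *)
have a_cvg : (a m @[m --> \oo]) --> p^'.
  move=> P nP.
  have /nbhs_ballP[e /= e0 eP] : nbhs p (fun y => y != p -> P y) := nP.
  have e4 : 0 < e / 4 by rewrite divr_gt0.
  have := near_eps_le (pow2V_cvg0 (R := R)) e4; apply: filterS => m me.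
  have am0 : 0 < \val (a m) by rewrite aE bump_left_gt0.
  apply: eP; last by rewrite -val_eqE pE gt_eqF.
  change (`|\val p - \val (a m)| < e).
  rewrite pE sub0r normrN gtr0_norm// aE /bump_left /uncoord.
  (* The first factor is below 2, so the bound [e / 4] on the second one suffices. *)
  have -> : (z m / 8 - 2^-1 + 6) / (8 * 2 ^+ m) =
      (z m / 8 - 2^-1 + 6) / 4 * (2 * 2 ^+ m)^-1.
    by field; rewrite gt_eqF ?pow2_gt0.
  have /andP[z0 z1] := zu m.
  have p0 : 0 <= (2 * 2 ^+ m : R)^-1 by exact: pow2V_ge0.
  by nra.
have rc : (fun m => bump_left z' m / bump_left z m) @ \oo --> c.
  rewrite (_ : (fun m => _) = diffquot01 (fun t => \val (g t)) p \o a).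
    exact: cvg_comp a_cvg cP.
  by apply/funext => m; rewrite /diffquot01 /= ga g_o pE !subr0 aE aE'.
(* The endpoint [bump_left z m] equals (44 + z m) / (64 * 2^m), so the ratio is (44 + z' m) / (44 +
   z m). Below, 45 bounds the factor [44 + z m]. *)
have rE m : z' m - z m = (bump_left z' m / bump_left z m - 1) * (44 + z m).
  have /andP[z0 z1] := zu m; rewrite /bump_left /uncoord.
  field; rewrite gt_eqF ?pow2_gt0//= gt_eqF//; lra.
(* The ratio is exactly 1 at the arbitrarily large indices where the codes agree, which pins down
   its limit. *)
have c1 : c = 1.
  apply/eqP; rewrite -subr_eq0 -normr_le0 leNgt; apply/negP => c0.
  have c2 : 0 < `|c - 1| / 2 by rewrite divr_gt0.
  have /cvgrPdist_le/(_ _ c2)[M _ MP] := rc.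
  have [m Mm zm] := zz' M; have := MP m Mm.
  by rewrite /bump_left zm divff ?gt_eqF ?bump_left_gt0//; lra.
rewrite c1 in rc; apply/cvgrPdist_le => e e0.
have e45 : 0 < e / 45 by rewrite divr_gt0.
have /cvgrPdist_le/(_ _ e45) := rc; apply: filterS => m me.
have /andP[z0 z1] := zu m.
rewrite sub0r normrN rE normrM -normrN opprB [`|44 + _|]gtr0_norm ?ltr_wpDr//.
apply: (@le_trans _ _ (e / 45 * 45)); last by rewrite divfK.
by apply: ler_pM => //; lra.
Qed.

End conjugacy.

(** * Encoding into [0,1]-valued sequences *)

Section truncation_code.
Context {R : realType}.
Implicit Types (x y : nat -> R) (s t r e : R) (k m n : nat).

(** Truncation at 1 makes the code constant in [k] from some rank on for each [n], so that each [n]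
    contributes finitely many informative indices. The default 1, for an [m] encoding no pair,
    cancels in differences. *)
Definition code x m : R :=
  if pickle_inv m is Some (n, k) then Num.min 1 (k.+1%:R * x n) else 1.

Lemma code_pickle x n k :
  code x (pickle (n, k)) = Num.min 1 (k.+1%:R * x n).
Proof. by rewrite /code pickleK_inv. Qed.

Lemma codeP m : (exists n k, m = pickle (n, k)) \/ (forall x, code x m = 1).
Proof.
rewrite /code; case E: (pickle_inv m) => [[n k]|]; last by right.
by left; exists n, k; have := pickle_invK (T := (nat * nat)%type) m; rewrite E.
Qed.

Lemma code_unit_valued x : (forall n, 0 < x n < 1) -> unit_valued (code x).
Proof.
move=> x01 m; rewrite /code; case: (pickle_inv m) => [[n k]|]; last first.
  by rewrite ler01 lexx.
have /andP[x0 _] := x01 n.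
by rewrite le_min ler01 ge_min lexx mulr_ge0// ltW.
Qed.

(** Only finitely many pairs are encoded below [M]; [N] exceeds all their coordinates. *)
Lemma pickle_large M : exists N, forall n k, (N <= n)%N || (N <= k)%N ->
  (M <= pickle (n, k))%N.
Proof.
pose c m := if pickle_inv m is Some (n, k) then maxn n k else 0%N.
exists (\max_(m < M) c m).+1 => n k H; rewrite leqNgt; apply/negP => mM.
have := leq_bigmax (F := fun m : 'I_M => c m) (Ordinal mM).
by rewrite /c /= pickleK_inv geq_max leqNgt [(k <= _)%N]leqNgt -negb_or H.
Qed.

Lemma trunc_one s k : 0 < s -> (Num.truncn s^-1 <= k)%N ->
  Num.min 1 (k.+1%:R * s) = 1.
Proof.
move=> s0; rewrite truncn_le_nat => sk.
by rewrite min_l// -ler_pdivrMr// div1r ltW.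
Qed.

Lemma code_agree x y : (forall n, 0 < x n < 1) -> (forall n, 0 < y n < 1) ->
  forall M, exists2 m, (M <= m)%N & code x m = code y m.
Proof.
move=> x01 y01 M; have [N NP] := pickle_large M.
have /andP[x0 _] := x01 0; have /andP[y0 _] := y01 0.
pose k := maxn N (maxn (Num.truncn (x 0)^-1) (Num.truncn (y 0)^-1)).
exists (pickle (0%N, k)); first by rewrite NP// leq_maxl orbT.
by rewrite !code_pickle !trunc_one// /k !leq_max leqnn !orbT.
Qed.

(** Passing from [w] to [r * w] is a relative change of |r - 1|, and truncation leaves only values
    up to 1, whence a bound uniform in [w]. *)
Lemma trunc_ratio_le (w r : R) : 0 < w -> 0 < r ->
  `|Num.min 1 w - Num.min 1 (r * w)| <= `|r - 1|.
Proof.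
move=> w0 r0; case: (leP 0 (r - 1)) => r1.
  rewrite (ger0_norm r1) ler_norml.
  by case: (leP 1 w) => ?; case: (leP 1 (r * w)) => ?; apply/andP; split; nra.
rewrite (ltr0_norm r1) ler_norml.
by case: (leP 1 w) => ?; case: (leP 1 (r * w)) => ?; apply/andP; split; nra.
Qed.

Lemma ratio_le_trunc s t e : 0 < s < 1 -> 0 < t < 1 -> e <= 4^-1 ->
  (forall k, `|Num.min 1 (k.+1%:R * t) - Num.min 1 (k.+1%:R * s)| <= e) ->
  `|s / t - 1| <= 4 * e.
Proof.
move=> /andP[s0 s1] /andP[t0 t1] e4 H.
pose M := Num.max s t.
have M0 : 0 < M by rewrite lt_max s0.
have M1 : M < 1 by rewrite gt_max s1.
have sM : s <= M by rewrite le_max lexx.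
have tM : t <= M by rewrite le_max lexx orbT.
(* The multiplier K is the largest integer with K * M at most 1: neither product is truncated, yet
   the larger one is at least 1/2. *)
have [k kE] : exists k, Num.truncn M^-1 = k.+1.
  by exists (Num.truncn M^-1).-1; rewrite prednK// truncn_gt0 invf_ge1// ltW.
have M'0 : 0 <= M^-1 by rewrite invr_ge0 ltW.
have /andP[] := truncn_itv M'0; rewrite kE.
rewrite -div1r ler_pdivlMr// ltr_pdivrMr// => kM Mk.
have k1 : 1 <= k.+1%:R :> R by rewrite ler1n.
have k2 : k.+2%:R = k.+1%:R + 1 :> R by rewrite -natr1.
move: Mk (H k); rewrite k2; set K : R := k.+1%:R in kM k1 * => Mk.
rewrite !min_r; last 2 first.
- by rewrite (le_trans _ kM)// ler_wpM2l// (le_trans ler01).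
- by rewrite (le_trans _ kM)// ler_wpM2l// (le_trans ler01).
have KM : 1 <= 2 * (K * M) by nra.
have -> : s / t - 1 = (s - t) / t by field; rewrite gt_eqF.
rewrite normrM [`|t^-1|]gtr0_norm ?invr_gt0// ler_pdivrMr//.
have K0 : 0 <= K by rewrite (le_trans ler01).
rewrite -mulrBr normrM (ger0_norm K0) distrC; set u := `|s - t| => le.
have u0 : 0 <= u := normr_ge0 _.
have uM : u <= 2 * e * M.
  have : u * 1 <= u * (2 * (K * M)) by rewrite ler_wpM2l.
  have : M * (K * u) <= M * e by rewrite ler_pM2l.
  by lra.
(* If [t] is the larger number, |s - t| <= 2 * e * M is enough. Otherwise [e <= 4^-1] forces s <= 2
   * t, which costs another factor 2. *)
have [st|ts] := leP s t; first by move: uM; rewrite /M max_r//; nra.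
move: uM; rewrite /M (max_l (ltW ts)) /u gtr0_norm ?subr_gt0// => uM.
have st2 : s <= 2 * t by nra.
by nra.
Qed.

Lemma code_cvg x y : (forall n, 0 < x n < 1) -> (forall n, 0 < y n < 1) ->
  (fun n => x n / y n) @ \oo --> (1 : R) <->
  (fun m => code y m - code x m) @ \oo --> (0 : R).
Proof.
move=> x01 y01.
have x0 n : 0 < x n by have /andP[] := x01 n.
have y0 n : 0 < y n by have /andP[] := y01 n.
split=> /cvgrPdist_le H; apply/cvgrPdist_le => e e0.
- have [N _ NP] := H e e0.
  (* For n >= N the ratio bound applies for all [k]; for n < N and k >= K n both codes are 1. The
     finitely many remaining pairs are avoided by taking [m] beyond their largest index. *)
  pose K n := maxn (Num.truncn (x n)^-1) (Num.truncn (y n)^-1).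
  pose c n := \max_(k < K n) pickle (n, nat_of_ord k).
  exists (\max_(n < N) c n).+1 => // m /= mB; rewrite sub0r normrN.
  have [[n [k mE]]|E] := codeP m; last by rewrite !E subrr normr0 ltW.
  rewrite mE !code_pickle; have [Nn|nN] := leqP N n.
    have := NP n Nn; rewrite distrC; apply: le_trans.
    have -> : k.+1%:R * x n = x n / y n * (k.+1%:R * y n).
      by field; rewrite gt_eqF.
    by apply: trunc_ratio_le; [rewrite mulr_gt0 | rewrite divr_gt0].
  have [Kk|kK] := leqP (K n) k.
    move: Kk; rewrite geq_max => /andP[xk yk].
    by rewrite !trunc_one// subrr normr0 ltW.
  move: mB; rewrite ltnNge mE => /negP[].
  apply: (@leq_trans (c n)).
    exact: (leq_bigmax (F := fun k : 'I_(K n) => pickle (n, nat_of_ord k))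
      (Ordinal kK)).
  exact: (leq_bigmax (F := fun n : 'I_N => c n) (Ordinal nN)).
(* The tolerance must be at most 1/4 for [ratio_le_trunc], whose conclusion then loses a factor
   4. *)
- have e'0 : 0 < Num.min (e / 4) 4^-1 by rewrite lt_min divr_gt0//= invr_gt0.
  have [M _ MP] := H _ e'0; have [N NP] := pickle_large M.
  exists N => // n /= Nn; rewrite distrC.
  have e'4 : Num.min (e / 4) 4^-1 <= 4^-1 by rewrite ge_min lexx orbT.
  apply: le_trans (ratio_le_trunc (x01 n) (y01 n) e'4 _) _ => [k|].
    have := MP (pickle (n, k)); rewrite /= NP ?Nn// => /(_ isT).
    by rewrite !code_pickle sub0r normrN.
  by rewrite mulrC -ler_pdivlMr// ge_min lexx.
Qed.

End truncation_code.

(** * Continuity of the encoding, hence its Borel measurability *)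

Lemma continuous_borel (X Y : ptopologicalType) (f : X -> Y) :
  continuous f ->
  measurable_fun [set: borelType X] (f : borelType X -> borelType Y).
Proof.
move=> /continuousP cf.
apply: (@measurability _ _ (borelType X) (borelType Y) setT f (@open Y)) => //.
move=> _ [B oB <-]; rewrite setTI; apply: sub_sigma_algebra; exact: cf.
Qed.

Section continuity.
Context {R : realType}.
Implicit Types (z : nat -> R) (m : nat).

Lemma supdist01_le (u v : I01 R -> R) e : (forall t, `|u t - v t| <= e) ->
  supdist01 u v <= e.
Proof.
move=> H; apply: ge_sup => [|_ [t _ <-]//].
have [p _] : exists p : I01 R, \val p = 0.
  by apply: I01_lift; rewrite lexx ler01.
by exists `|u p - v p|, p.
Qed.

(** The slots are disjoint, so the errors of different slots do not add up. *)
Lemma glue_dist (B B' : nat -> R -> R) t e :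
  slotted B -> slotted B' -> 0 <= e ->
  (forall m, `|B m t - B' m t| <= e) -> `|glue B t - glue B' t| <= e.
Proof.
move=> sB sB' e0 H; have [[m mt]|N] := slot_dec t.
  by rewrite (glue_in sB mt) (glue_in sB' mt).
by rewrite !glue_out// subrr normr0.
Qed.

(** The argument of [bump] moves by a quarter of |z m - z' m|, which offsets the Lipschitz constant
    4. The damping factor is kept to make late coordinates of the code negligible. *)
Lemma moving_bump_dist z z' m s :
  `|moving_bump z m s - moving_bump z' m s| <= (2 * 2 ^+ m)^-1 * `|z m - z' m|.
Proof.
rewrite -mulrBr normrM ger0_norm ?pow2V_ge0//.
apply: ler_pM; rewrite ?pow2V_ge0 ?ler_pow2V ?ler_nat//.
apply: (le_trans (bump_lip _ _)).
rewrite (_ : _ - _ = 4^-1 * (z' m - z m)); last by field.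
rewrite normrM distrC ger0_norm ?invr_ge0//.
by have := normr_ge0 (z m - z' m); lra.
Qed.

Lemma dmoving_bump_dist z z' m s :
  `|dmoving_bump z m s - dmoving_bump z' m s| <=
    (2 * 2 ^+ m)^-1 * `|z m - z' m|.
Proof.
rewrite -mulrBr normrM ger0_norm ?pow2V_ge0//.
rewrite (_ : (2 * 2 ^+ m)^-1 * _ =
    (8 * 2 ^+ m)^-1 * (4 * `|z m - z' m|)); last first.
  by field; rewrite gt_eqF ?pow2_gt0.
apply: ler_wpM2l; first exact: pow2V_ge0.
apply: (le_trans (dbump_lip _ _)).
rewrite (_ : _ - _ = 4^-1 * (z' m - z m)); last by field.
rewrite normrM distrC ger0_norm ?invr_ge0//.
by have := normr_ge0 (z m - z' m); lra.
Qed.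

Lemma bump_diff01_dist z z' (f f' : diff01 R) e :
  unit_valued z -> unit_valued z' ->
  (forall x, \val (f x) = perturb (moving_bump z) (\val x) /\
    diff01_derive f x = dperturb (dmoving_bump z) (\val x)) ->
  (forall x, \val (f' x) = perturb (moving_bump z') (\val x) /\
    diff01_derive f' x = dperturb (dmoving_bump z') (\val x)) ->
  0 <= e -> (forall m, (2 * 2 ^+ m)^-1 * `|z m - z' m| <= e) ->
  dist_diff01 f f' <= e + e.
Proof.
move=> zu zu' fE fE' e0 H; apply: lerD; apply: supdist01_le => t.
  have [-> _] := fE t; have [-> _] := fE' t.
  rewrite /perturb opprD addrACA subrr add0r; apply: glue_dist => // [||m].
  - exact/slotted_scaled/vanishing_moving_bump.
  - exact/slotted_scaled/vanishing_moving_bump.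
  rewrite /scaled -mulrBl normrM [`|_^-1|]ger0_norm ?pow2V_ge0//.
  rewrite (le_trans _ (H m))//.
  rewrite (le_trans _ (moving_bump_dist _ _ _ (coord m (\val t))))//.
  rewrite ler_piMr// invf_le1 ?mulr_gt0 ?pow2_gt0//.
  by rewrite mulr_ege1 ?exprn_ege1 ?ler1n.
have [_ ->] := fE t; have [_ ->] := fE' t.
rewrite /dperturb opprD addrACA subrr add0r; apply: glue_dist => // [||m].
- exact/slotted_dscaled/vanishing_dmoving_bump.
- exact/slotted_dscaled/vanishing_dmoving_bump.
exact: le_trans (dmoving_bump_dist _ _ _ _) (H m).
Qed.

Lemma O01_itv (x : O01 R) : 0 < \val x < 1.
Proof. by have := set_valP x; rewrite /O01 /= in_itv. Qed.

Definition seq_code (x : O01_seq R) : nat -> R := code (fun n => \val (x n)).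

Lemma seq_code_unit_valued x : unit_valued (seq_code x).
Proof. by apply: code_unit_valued => n; exact: O01_itv. Qed.

Lemma continuous_seq_code m : continuous (fun x : O01_seq R => seq_code x m).
Proof.
rewrite /seq_code /code; case: (pickle_inv m) => [[n k]|]; last first.
  exact: cst_continuous.
have cx : continuous (fun x : O01_seq R => \val (x n)).
  move=> x; apply: (@continuous_comp _ _ _ (fun x : O01_seq R => x n)).
    exact: proj_continuous.
  exact: initial_continuous.
have cm : continuous (fun r : R => Num.min 1 (k.+1%:R * r)).
  move=> r; have c1 : {for r, continuous (cst 1 : R -> R^o)}.
    exact: cst_continuous.
  have c2 : {for r, continuous (fun r : R => k.+1%:R * r : R^o)}.
    by apply: cvgM => //; exact: cvg_cst.
  exact: (continuous_min c1 c2).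
by move=> x; exact: continuous_comp (cx x) (cm _).
Qed.

(** A neighbourhood in the product topology controls only finitely many code coordinates; beyond
    rank [M] the damping alone suffices, since two codes differ by at most 1. *)
Lemma continuous_bump_diff01 (F : O01_seq R -> diff01 R) :
  (forall x t, \val (F x t) = perturb (moving_bump (seq_code x)) (\val t) /\
    diff01_derive (F x) t = dperturb (dmoving_bump (seq_code x)) (\val t)) ->
  continuous F.
Proof.
move=> FE x P /nbhs_ballP[e /= e0 eP].
have e4 : 0 < e / 4 by rewrite divr_gt0.
have [M _ MP] := near_eps_le (pow2V_cvg0 (R := R)) e4.
have : \forall y \near x, forall m : 'I_M,
    `|seq_code x m - seq_code y m| <= e / 4.
  apply: (@filter_forall _ _ (fun (m : 'I_M) y => is_true
    (`|seq_code x m - seq_code y m| <= e / 4)) (nbhs x) (nbhs_filter x)) => m.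
  have /(@cvgrPdist_le _ _ _ (nbhs x) (nbhs_filter x)) :=
    @continuous_seq_code m x.
  exact.
apply: (@filterS _ (nbhs x) (nbhs_filter x)) => y xy; apply: eP; rewrite ballEmdist /=.
apply: (@le_lt_trans _ _ (e / 4 + e / 4)); last by lra.
apply: (bump_diff01_dist (z := seq_code x) (z' := seq_code y)) => //.
- exact: seq_code_unit_valued.
- exact: seq_code_unit_valued.
- exact: ltW.
move=> m; have p1 : (2 * 2 ^+ m)^-1 <= 1 :> R.
  rewrite invf_le1 ?mulr_gt0 ?pow2_gt0//.
  by rewrite mulr_ege1 ?exprn_ege1 ?ler1n.
have p0 : 0 <= (2 * 2 ^+ m)^-1 :> R by exact: pow2V_ge0.
have [mM|Mm] := ltnP m M.
  by rewrite (le_trans _ (xy (Ordinal mM)))// ler_piMl.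
rewrite (le_trans _ (MP m Mm))// ler_piMr// ler_norml.
have /andP[? ?] := seq_code_unit_valued x m.
have /andP[? ?] := seq_code_unit_valued y m.
by apply/andP; split; lra.
Qed.

End continuity.

(** * Assembling the reduction *)

Theorem theorem3p19 (R : realType) :
  borel_reducible (O01_seq R) (diff01 R) (@c0x R) (@conj_diff01 R).
Proof.
have /choice[F FE] : forall x : O01_seq R, exists f : diff01 R, forall t,
    \val (f t) = perturb (moving_bump (seq_code x)) (\val t) /\
    diff01_derive f t = dperturb (dmoving_bump (seq_code x)) (\val t).
  by move=> x; apply: exists_bump_diff01; exact: seq_code_unit_valued.
exists F.
  apply: (@continuous_borel (O01_seq R) (diff01 R) F).
  exact: continuous_bump_diff01.
move=> x y; have xu := seq_code_unit_valued x; have yu := seq_code_unit_valued y.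
have x01 n := O01_itv (x n); have y01 n := O01_itv (y n).
have Fx t := (FE x t).1; have Fy t := (FE y t).1.
rewrite /c0x (code_cvg x01 y01); split=> [d0|[g gF]]; last first.
  exact: conj_bump_cvg xu yu Fx Fy (code_agree x01 y01) gF.
(* The bump centres are [z m / 8], so this is the translation between the centres for [x] and for
   [y]. *)
pose d m := (seq_code y m - seq_code x m) / 8.
have [m||g gE] := @exists_shift_diff01 R d.
- have /andP[? ?] := xu m; have /andP[? ?] := yu m.
  by rewrite /d ler_norml; apply/andP; split; lra.
- by rewrite /d -(mul0r 8^-1); apply: cvgM => //; exact: cvg_cst.
(* Writing the argument of [F y] as the image under [g] of its preimage turns the goal into
   [perturb_conj] at that preimage. *)
exists g; apply/funext => t /=; rewrite -{2}(homeo01_invK g t).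
by apply/val_inj; rewrite gE Fx Fy gE perturb_conj.
Qed.
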